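(* Let $f_1:S_1\to O$ and $f_2:S_2\to O$ be regular fibrations over a common base $O$, with regular lifting functions $L_{f_1}, L_{f_2}$, and let $r_o\in O$, $F^i_{r_o}=f_i^{-1}(r_o)$ for $i=1,2$. Let $s_o\in F^1_{r_o}$ and suppose that $f_1$ and $f_2$ have conjugate $Lf$-restrictions $f_1^{s_o}$ and $f_2^{g(s_o)}$ by a homotopy equivalence $g:F^1_{r_o}\to F^2_{r_o}$ with homotopy inverse $g'$, i.e. $f_1^{s_o}\simeq g'\circ f_2^{g(s_o)}$. Then there are two fiber maps $$h:\Gamma(S_1,F^1_{r_o},s_o)\to\Gamma(S_2,F^2_{r_o},g(s_o)),\qquad k:\Gamma(S_2,F^2_{r_o},g(s_o))\to\Gamma(S_1,F^1_{r_o},(g'\circ g)(s_o))$$ over $g$ and $g'$ respectively, that is, continuous maps with $$\Psi_{g(s_o)}\circ h=g\circ\Psi_{s_o},\qquad \Psi_{(g'\circ g)(s_o)}\circ k=g'\circ\Psi_{g(s_o)}.$$ Further, the groups $\pi_n(S_1,s_o)$ and $\pi_n(S_2,g(s_o))$ are isomorphic for every integer $n>1$.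
   Context: All spaces are Hausdorff; $I=[0,1]$, $S^I$ is the space of paths in $S$ with the compact-open topology, $\widetilde{s}$ is the constant path at $s$, $\Omega(O,r_o)\subset O^I$ is the space of loops at $r_o$, and $\simeq$ denotes homotopy of maps. ''Fibration'' means Hurewicz fibration. For a fibration $f:S\to O$ let $\bigtriangleup f=\{(s,\alpha)\in S\times O^I: f(s)=\alpha(0)\}$. A lifting function for $f$ is a continuous map $L_f:\bigtriangleup f\to S^I$ with $L_f(s,\alpha)(0)=s$ and $f\circ L_f(s,\alpha)=\alpha$; it is regular if $L_f(s,f\circ\widetilde{s})=\widetilde{s}$ for all $s\in S$. A fibration is regular if it has a regular lifting function. For $F_{r_o}=f^{-1}(r_o)$, the $Lf$-function of $f$ induced by $L_f$ is $\Theta_{L_f}:\Omega(O,r_o)\times F_{r_o}\to F_{r_o}$, $\Theta_{L_f}(\alpha,s)=L_f(s,\alpha)(1)$. For $s\in F_{r_o}$ the $Lf$-restriction is the map $f^{s}:\Omega(O,r_o)\to F_{r_o}$, $f^{s}(\alpha)=\Theta_{L_f}(\alpha,s)$. For a subspace $F\subset S$ and $s\in F$, $\Gamma(S,F,s)=\{\alpha\in S^I:\alpha(0)=s,\ \alpha(1)\in F\}$. For a fibration $f:S\to O$ with fiber $F_{r_o}$ and $s\in F_{r_o}$, $\Psi_{s}:\Gamma(S,F_{r_o},s)\to F_{r_o}$ is the fibration $\Psi_s(\alpha)=\alpha(1)$. *)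

(* Defs.v *)
From HB Require Import structures.
From mathcomp Require Import all_boot all_order all_algebra.
From mathcomp Require Import generic_quotient.
From mathcomp Require Import all_classical all_reals topology normedtype.
From mathcomp Require Import homotopy.
From mathcomp Require Import lra.

Set Implicit Arguments.
Unset Strict Implicit.
Unset Printing Implicit Defensive.

Import Order.TTheory GRing.Theory Num.Theory.
Import numFieldNormedType.Exports.

Local Open Scope classical_set_scope.
Local Open Scope ring_scope.

Definition unit_interval (R : realType) : Type :=
  set_type (`[0, 1]%classic : set R).

HB.instance Definition _ (R : realType) :=
  Topological.copy (unit_interval R) (set_type (`[0, 1]%classic : set R)).
HB.instance Definition _ (R : realType) :=
  SubType.copy (unit_interval R) (set_type (`[0, 1]%classic : set R)).

Section unit_interval.
Context {R : realType}.
Implicit Types (r : R) (u : unit_interval R).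

Definition uval u : R := \val u.

Lemma clamp_subproof r : Num.max 0 (Num.min 1 r) \in (`[0, 1]%classic : set R).
Proof.
by rewrite inE/= in_itv/= le_max lexx/= ge_max ler01 ge_min lexx.
Qed.

Definition clamp r : unit_interval R :=
  exist (fun x => x \in (`[0, 1]%classic : set R)) _ (clamp_subproof r).

Arguments uval : simpl never.
Arguments clamp : simpl never.

Lemma unitP u : 0 <= uval u <= 1.
Proof. by have := valP u; rewrite inE/= in_itv. Qed.

Lemma val_clamp r : 0 <= r <= 1 -> uval (clamp r) = r.
Proof. by move=> /andP[r0 r1]; rewrite /uval/= (min_r r1) (max_r r0). Qed.

Lemma valK_clamp u : clamp (uval u) = u.
Proof. by apply: val_inj; exact: val_clamp (unitP u). Qed.

Lemma uval_inj : injective uval.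
Proof. exact: val_inj. Qed.

Lemma clamp_le0 r : r <= 0 -> clamp r = clamp 0.
Proof.
move=> r0; apply: uval_inj; rewrite [RHS]val_clamp ?lexx ?ler01// /uval/=.
by rewrite (min_r (le_trans r0 ler01)) max_l.
Qed.

Lemma clamp_ge1 r : 1 <= r -> clamp r = clamp 1.
Proof. by move=> r1; apply: uval_inj; rewrite /uval/= minxx min_l. Qed.

Lemma clamp01_neq : clamp 0 != clamp 1.
Proof.
apply/eqP => /(congr1 uval); rewrite !val_clamp ?lexx ?ler01// => /eqP.
by rewrite eq_sym oner_eq0.
Qed.

(* The end points 0 and 1 are written [zero] and [one], as for paths in the
   library. *)
HB.instance Definition _ := isBiPointed.Build (unit_interval R) clamp01_neq.

Lemma val_zero : uval (zero : unit_interval R) = 0.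
Proof. by rewrite val_clamp ?lexx ?ler01. Qed.

Lemma val_one : uval (one : unit_interval R) = 1.
Proof. by rewrite val_clamp ?lexx ?ler01. Qed.

Lemma continuous_val_unit : continuous uval.
Proof. exact: (@initial_continuous _ _ (set_val : unit_interval R -> R)). Qed.

Lemma continuous_clamp : continuous clamp.
Proof.
apply: (@continuous_comp_initial _ _ _ (set_val : unit_interval R -> R)) => r.
have -> : set_val \o clamp = (fun r : R => Num.max 0 (Num.min 1 r)).
  by apply/funext.
apply: (@continuous_max _ R (fun=> 0) (fun r => Num.min 1 r)).
  exact: cvg_cst.
apply: (@continuous_min _ R (fun=> 1) id); first exact: cvg_cst.
exact: cvg_id.
Qed.

End unit_interval.

(* The topology of [continuousType] is not fixed by the library; the path space
   S^I carries the topology induced from the compact-open one. *)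
Definition path_space (R : realType) (S : topologicalType) : Type :=
  continuousType (unit_interval R) S.

HB.instance Definition _ (R : realType) (S : topologicalType) :=
  Choice.copy (path_space R S) (continuousType (unit_interval R) S).
HB.instance Definition _ (R : realType) (S : topologicalType) :=
  Topological.copy (path_space R S)
    (initial_topology (id : path_space R S ->
                            {compact-open, unit_interval R -> S})).

Definition const_path (R : realType) (S : topologicalType) (s : S) :
  path_space R S := cst s : continuousType (unit_interval R) S.

Definition comp_path (R : realType) (S O : topologicalType)
    (f : continuousType S O) (a : path_space R S) : path_space R O :=
  f \o a : continuousType (unit_interval R) O.

Definition loop_space (R : realType) (O : topologicalType) (r : O) : Type :=
  {path (unit_interval R) from r to r in O}.

HB.instance Definition _ (R : realType) (O : topologicalType) (r : O) :=
  Topological.copy (loop_space R r) {path (unit_interval R) from r to r in O}.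

Definition homotopic (R : realType) (X Y : topologicalType) (f g : X -> Y) :=
  exists H : X * unit_interval R -> Y,
    [/\ continuous H, forall x, H (x, zero) = f x & forall x, H (x, one) = g x].

Definition homotopy_equivalence (R : realType) (X Y : topologicalType)
    (g : X -> Y) (g' : Y -> X) : Prop :=
  [/\ continuous g, continuous g',
      homotopic R (g' \o g) id & homotopic R (g \o g') id].

(* The homotopy lifting property with respect to all Hausdorff spaces. *)
Definition fibration (R : realType) (S O : topologicalType) (f : S -> O) :=
  forall (X : topologicalType) (h : X -> S) (H : X * unit_interval R -> O),
    hausdorff_space X -> continuous h -> continuous H ->
    (forall x, H (x, zero) = f (h x)) ->
  exists G : X * unit_interval R -> S,
    [/\ continuous G, forall x, G (x, zero) = h x & f \o G = H].

Definition fiber (S O : Type) (f : S -> O) (r : O) : set S := f @^-1` [set r].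

Section lifting.
Context {R : realType} {S O : topologicalType} (f : continuousType S O).

(* The space of pairs (s, alpha) written with a triangle in front of f. *)
Definition lifting_domain : set (S * path_space R O) :=
  [set p : S * path_space R O | f p.1 = p.2 zero].

Definition lifting_pair (s : S) (a : path_space R O) (fsa : f s = a zero) :
    lifting_domain :=
  SigSub (mem_set (fsa : lifting_domain (s, a))).

Record lifting_function := LiftingFunction {
  lift_path :> lifting_domain -> path_space R S;
  lift_path_continuous : continuous lift_path;
  lift_path_zero : forall p, lift_path p zero = (\val p).1;
  lift_pathK : forall p, comp_path f (lift_path p) = (\val p).2 }.

Definition regular (L : lifting_function) : Prop :=
  forall s, @L (lifting_pair (erefl : f s = comp_path f (const_path R s) zero))
            = const_path R s.

Definition regular_fibration : Prop :=
  fibration R f /\ exists L : lifting_function, regular L.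

Section Lf_function.
Variables (L : lifting_function) (r : O).

Lemma lift_fiber_subproof (a : loop_space R r) (s : fiber f r) :
  f (\val s) = (a : path_space R O) zero.
Proof. exact: etrans (set_mem (valP s)) (esym (@path_zero _ _ _ _ a)). Qed.

Lemma Lf_function_subproof (a : loop_space R r) (s : fiber f r) :
  fiber f r (L (lifting_pair (lift_fiber_subproof a s)) one).
Proof.
have La := lift_pathK L (lifting_pair (lift_fiber_subproof a s)).
have Lr := congr1 (fun b : path_space R O => b one) La.
exact: etrans Lr (@path_one _ _ _ _ a).
Qed.

(* Theta_L : Omega(O, r) x F_r -> F_r, (alpha, s) |-> L(s, alpha)(1). *)
Definition Lf_function (p : loop_space R r * fiber f r) : fiber f r :=
  SigSub (mem_set (Lf_function_subproof p.1 p.2)).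

Definition Lf_restriction (s : fiber f r) (a : loop_space R r) : fiber f r :=
  Lf_function (a, s).

End Lf_function.
End lifting.
Arguments lifting_function R {S O} f.
Arguments regular_fibration R {S O} f.

Section Gamma.
Context {R : realType} {S : topologicalType}.

Definition Gamma (F : set S) (s : S) : set (path_space R S) :=
  [set a | a zero = s /\ F (a one)].

Lemma Gamma_end_subproof (F : set S) (s : S) (a : Gamma F s) : F (\val a one).
Proof. by have [] := set_mem (valP a). Qed.

(* The map Psi_s. *)
Definition Gamma_end (F : set S) (s : S) (a : Gamma F s) : F :=
  SigSub (mem_set (Gamma_end_subproof a)).

End Gamma.
Arguments Gamma R {S} F s.
Arguments Gamma_end {R S F s} a.

Definition homotopic_rel (R : realType) (X Y : topologicalType) (A : set X)
    (f g : X -> Y) : Prop :=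
  exists H : X * unit_interval R -> Y,
    [/\ continuous H, forall x, H (x, zero) = f x, forall x, H (x, one) = g x
      & forall x u, A x -> H (x, u) = f x].

Definition cube (R : realType) (n : nat) : Type :=
  prod_topology (fun _ : 'I_n => unit_interval R).

HB.instance Definition _ (R : realType) (n : nat) :=
  Topological.copy (cube R n) (prod_topology (fun _ : 'I_n => unit_interval R)).

Definition cube_boundary (R : realType) (n : nat) : set (cube R n) :=
  [set t | exists i, t i = zero \/ t i = one].

Lemma paste_continuous (R : realType) (T X : topologicalType) (p : T -> R)
    (c : R) (f g : T -> X) :
  continuous p -> continuous f -> continuous g ->
  (forall t, p t = c -> f t = g t) ->
  continuous (fun t => if p t <= c then f t else g t).
Proof.
move=> cp cf cg fg t U /=; have [ptc|cpt|ptc] := ltgtP (p t) c => nU.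
- have nlt : nbhs t (p @^-1` [set r | r < c]) by exact: cp (lt_nbhsl ptc).
  have nf : nbhs t (f @^-1` U) by exact: cf nU.
  by apply: filterS2 nlt nf => t' /= pt' Uft'; rewrite (ltW pt').
- have nlt : nbhs t (p @^-1` [set r | c < r]) by exact: cp (lt_nbhsr cpt).
  have ng : nbhs t (g @^-1` U) by exact: cg nU.
  by apply: filterS2 nlt ng => t' /= pt' Uft'; rewrite leNgt pt'.
- have nf : nbhs t (f @^-1` U) by exact: cf nU.
  have ng : nbhs t (g @^-1` U) by apply: cg; rewrite -fg.
  by apply: filterS2 nf ng => t' Uft' Ugt' /=; case: ifP.
Qed.

Section cube_maps.
Context {R : realType}.
Local Notation I := (unit_interval R).

Lemma continuous_coord n (i : 'I_n) : continuous (fun t : cube R n => t i).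
Proof.
exact: (@proj_continuous _ (fun _ : 'I_n => unit_interval R : topologicalType) i).
Qed.

Lemma continuous_cube n (T : topologicalType) (f : T -> cube R n) :
  (forall i, continuous (fun x => f x i)) -> continuous f.
Proof.
move=> cf x; apply/cvg_sup => i U [_ [[V oV <-] /= Vfx]] VU.
have nV : nbhs x ((fun y => f y i) @^-1` V).
  by apply: (cf i); exact: open_nbhs_nbhs.
by apply: filterS nV => y Vy; exact: VU.
Qed.

Lemma continuous_pair (T X Y : topologicalType) (f : T -> X) (g : T -> Y) :
  continuous f -> continuous g -> continuous (fun t => (f t, g t)).
Proof. by move=> cf cg t; apply: cvg_pair; [exact: cf|exact: cg]. Qed.

Lemma continuous_scomp (X Y Z : topologicalType) (f : X -> Y) (g : Y -> Z) :
  continuous f -> continuous g -> continuous (fun x => g (f x)).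
Proof. by move=> cf cg x; apply: continuous_comp; [exact: cf|exact: cg]. Qed.

Lemma continuous_set_coord n (T : topologicalType) (f : T -> cube R n) (i : 'I_n)
    (u : T -> I) : continuous f -> continuous u ->
  continuous (fun x => dfwith (f x) i (u x) : cube R n).
Proof.
move=> cf cu; apply: continuous_cube => j.
have [->|ij] := eqVneq i j.
  by rewrite (_ : (fun _ => _) = u)//; apply/funext => x; rewrite dfwithin.
rewrite (_ : (fun _ => _) = (fun x => f x j)).
  exact: continuous_scomp cf (@continuous_coord n j).
by apply/funext => x; rewrite dfwithout.
Qed.

Lemma continuous_affine (T : topologicalType) (p : T -> R) (a b : R) :
  continuous p -> continuous (fun t => a * p t + b).
Proof.
move=> cp t.
by apply: cvgD; [apply: cvgM; [exact: cvg_cst|exact: cp]|exact: cvg_cst].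
Qed.

Lemma continuous_aff (T : topologicalType) (p : T -> R) (a b : R) :
  continuous p -> continuous (fun t => clamp (a * p t + b)).
Proof.
move=> cp; apply: (continuous_scomp _ continuous_clamp).
exact: continuous_affine.
Qed.

Lemma continuous_minr (T : topologicalType) (p q : T -> R) :
  continuous p -> continuous q -> continuous (fun t => Num.min (p t) (q t)).
Proof.
by move=> cp cq t; exact: (continuous_min (cp t) (cq t)).
Qed.

Lemma continuous_maxr (T : topologicalType) (p q : T -> R) :
  continuous p -> continuous q -> continuous (fun t => Num.max (p t) (q t)).
Proof.
by move=> cp cq t; exact: (continuous_max (cp t) (cq t)).
Qed.

Lemma continuous_vfst n (T : topologicalType) (i : 'I_n) :
  continuous (fun p : cube R n * T => uval (p.1 i)).
Proof.
apply: (continuous_scomp _ continuous_val_unit).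
apply: (continuous_scomp _ (@continuous_coord n i)) => p; exact: cvg_fst.
Qed.

Lemma continuous_vsnd (T : topologicalType) :
  continuous (fun p : T * I => uval p.2).
Proof.
apply: (continuous_scomp _ continuous_val_unit) => p; exact: cvg_snd.
Qed.

Section homotopic_rel_equiv.
Context {X Y : topologicalType} (A : set X).
Implicit Types f g h : X -> Y.

Lemma homotopic_rel_refl f : continuous f -> homotopic_rel R A f f.
Proof.
move=> cf; exists (fun p => f p.1); split=> //.
by apply: (continuous_scomp _ cf) => p; exact: cvg_fst.
Qed.

Lemma homotopic_rel_sym f g : homotopic_rel R A f g -> homotopic_rel R A g f.
Proof.
move=> [H [cH H0 H1 HA]].
exists (fun p => H (p.1, clamp (-1 * uval p.2 + 1))); split.
- apply: (continuous_scomp _ cH); apply: continuous_pair.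
    by move=> p; exact: cvg_fst.
  by apply: continuous_aff; exact: continuous_vsnd.
- by move=> x /=; rewrite val_zero mulr0 add0r H1.
- by move=> x /=; rewrite val_one mulr1 addNr H0.
- by move=> x u Ax /=; rewrite HA// -H1 HA.
Qed.

Lemma homotopic_rel_trans f g h : homotopic_rel R A f g ->
  homotopic_rel R A g h -> homotopic_rel R A f h.
Proof.
move=> [H [cH H0 H1 HA]] [K [cK K0 K1 KA]].
exists (fun p => if uval p.2 <= 2^-1 then H (p.1, clamp (2 * uval p.2 + 0))
                 else K (p.1, clamp (2 * uval p.2 + -1))); split.
- apply: paste_continuous.
  + exact: continuous_vsnd.
  + apply: (continuous_scomp _ cH); apply: continuous_pair.
      by move=> p; exact: cvg_fst.
    by apply: continuous_aff; exact: continuous_vsnd.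
  + apply: (continuous_scomp _ cK); apply: continuous_pair.
      by move=> p; exact: cvg_fst.
    by apply: continuous_aff; exact: continuous_vsnd.
  + by move=> p ->; rewrite divff ?addr0 ?subrr ?H1 ?K0// pnatr_eq0.
- by move=> x /=; rewrite val_zero invr_ge0 ler0n mulr0 addr0 H0.
- move=> x /=; rewrite val_one ifF; last by apply/negbTE; rewrite -ltNge; lra.
  by rewrite (_ : 2 * 1 + -1 = 1) ?K1//; lra.
- move=> x u Ax /=; case: ifP => _; first by rewrite HA.
  by rewrite KA// -H1 HA.
Qed.

End homotopic_rel_equiv.
End cube_maps.

Section cube_loops.
Context {R : realType} (n : nat) {X : topologicalType} (x : X).

Definition cube_loops : set (continuousType (cube R n) X) :=
  [set a : continuousType (cube R n) X | forall t, cube_boundary t -> a t = x].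

Lemma cube_loopsP (a : cube_loops) t : cube_boundary t -> \val a t = x.
Proof. exact: (set_mem (valP a)). Qed.

Lemma cube_loops_cts (a : cube_loops) : continuous (\val a).
Proof. exact: cts_fun. Qed.

Definition cube_loop (f : cube R n -> X) (cf : continuous f)
    (fx : forall t, cube_boundary t -> f t = x) : cube_loops :=
  SigSub (mem_set (fx : cube_loops (mkcts cf : continuousType _ _))).

Definition loop_homotopic (a b : cube_loops) : bool :=
  `[< homotopic_rel R (@cube_boundary R n) (\val a) (\val b) >].

Lemma loop_homotopic_refl : reflexive loop_homotopic.
Proof. by move=> a; apply/asboolP/homotopic_rel_refl/cube_loops_cts. Qed.

Lemma loop_homotopic_sym : symmetric loop_homotopic.
Proof.
by move=> a b; apply/asboolP/asboolP; exact: homotopic_rel_sym.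
Qed.

Lemma loop_homotopic_trans : transitive loop_homotopic.
Proof.
move=> b a c /asboolP ab /asboolP bc; apply/asboolP.
exact: homotopic_rel_trans ab bc.
Qed.

Canonical loop_homotopic_equiv := EquivRel loop_homotopic
  loop_homotopic_refl loop_homotopic_sym loop_homotopic_trans.

(* The set pi_n(X, x) of classes of maps (I^n, boundary) -> (X, x); it is made a
   group below in dimension n.+1. *)
Definition homotopy_group : Type := {eq_quot loop_homotopic}%qT.

HB.instance Definition _ : EqQuotient _ loop_homotopic homotopy_group :=
  EqQuotient.on homotopy_group.
HB.instance Definition _ := Choice.on homotopy_group.

End cube_loops.
Arguments homotopy_group R n {X} x.

(* The group law concatenates along the first coordinate of the cube. *)

Section homotopy_group_law.
Context {R : realType} (n : nat) {X : topologicalType} (x : X).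
Local Notation I := (unit_interval R).
Local Notation cube := (cube R n.+1).
Local Notation loops := (@cube_loops R n.+1 X x).
Local Notation HG := (homotopy_group R n.+1 x).
Local Notation at0 t u := (dfwith t ord0 u : cube).
Local Notation homo := (homotopic_rel R (@cube_boundary R n.+1)).
Implicit Types (a b c : loops) (t : cube) (f g : cube -> X).

Definition concat f g t : X :=
  if uval (t ord0) <= 2^-1
  then f (at0 t (clamp (2 * uval (t ord0) + 0)))
  else g (at0 t (clamp (2 * uval (t ord0) + -1))).

Definition reverse f t : X := f (at0 t (clamp (-1 * uval (t ord0) + 1))).

Definition reparam (phi : I -> I) f t : X := f (at0 t (phi (t ord0))).

Definition based f := continuous f /\ forall t, cube_boundary t -> f t = x.

Lemma basedP a : based (\val a).
Proof. by split; [exact: cube_loops_cts|exact: cube_loopsP]. Qed.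

Definition endpoint (u : I) := u = zero \/ u = one.

Lemma boundary_at0 t u : cube_boundary t ->
  (endpoint (t ord0) -> endpoint u) -> cube_boundary (at0 t u).
Proof.
move=> [i ti] tu; have [i0|i0] := eqVneq ord0 i.
  by exists ord0; rewrite dfwithin; apply: tu; rewrite /endpoint i0.
by exists i; rewrite dfwithout.
Qed.

Lemma boundary_at0_end t u : endpoint u -> cube_boundary (at0 t u).
Proof. by move=> eu; exists ord0; rewrite dfwithin. Qed.

Lemma at0K t : at0 t (t ord0) = t.
Proof.
apply: functional_extensionality_dep => i.
by have [<-|?] := eqVneq ord0 i; rewrite ?dfwithin// dfwithout.
Qed.

Lemma at0_at0 t u v : at0 (at0 t u) v = at0 t v.
Proof.
apply: functional_extensionality_dep => i.
by have [<-|?] := eqVneq ord0 i; rewrite ?dfwithin// !dfwithout.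
Qed.

Lemma continuous_at0 (T : topologicalType) (q : T -> cube) (u : T -> I) :
  continuous q -> continuous u -> continuous (fun p => at0 (q p) (u p)).
Proof. by move=> cq cu; exact: continuous_set_coord. Qed.

Lemma reparam_based phi f : continuous phi ->
  (forall u, endpoint u -> endpoint (phi u)) -> based f -> based (reparam phi f).
Proof.
move=> cphi ephi [cf fx]; split.
  apply: (continuous_scomp _ cf); apply: continuous_at0; first by move=> ?.
  exact: (continuous_scomp (@continuous_coord _ _ _) cphi).
by move=> t bt; apply: fx; apply: boundary_at0 => // /ephi.
Qed.

Lemma reparam_homotopic (phi psi : I -> I) f :
  continuous phi -> continuous psi -> based f ->
  (forall u, endpoint u -> endpoint (phi u)) ->
  (forall u, endpoint u -> phi u = psi u) ->
  homo (reparam phi f) (reparam psi f).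
Proof.
move=> cphi cpsi [cf fx] ephi eq_phi.
pose s (p : cube * I) : R := (1 - uval p.2) * uval (phi (p.1 ord0))
                             + uval p.2 * uval (psi (p.1 ord0)).
exists (fun p => f (at0 p.1 (clamp (s p)))); split.
- apply: (continuous_scomp _ cf); apply: continuous_at0.
    by move=> p; exact: cvg_fst.
  apply: (continuous_scomp _ continuous_clamp) => p.
  have c0 : continuous (fun p : cube * I => p.1 ord0).
    by apply: (continuous_scomp _ (@continuous_coord _ _ _)) => ?; exact: cvg_fst.
  have cv h : continuous h -> continuous (fun p : cube * I => uval (h (p.1 ord0))).
    move=> ch; apply: (continuous_scomp _ continuous_val_unit).
    exact: continuous_scomp c0 ch.
  apply: cvgD; apply: cvgM.
  + by apply: cvgB; [exact: cvg_cst|exact: continuous_vsnd].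
  + exact: cv.
  + exact: continuous_vsnd.
  + exact: cv.
- by move=> t; rewrite /s /= val_zero subr0 mul1r mul0r addr0 valK_clamp.
- by move=> t; rewrite /s /= val_one subrr mul1r mul0r add0r valK_clamp.
- move=> t u bt; have [_ ->//] := reparam_based cphi ephi (conj cf fx).
  apply: fx; apply: boundary_at0 => //= e0.
  rewrite /s/= -(eq_phi _ e0) -mulrDl subrK mul1r valK_clamp; exact: ephi.
Qed.

Lemma concat_boundary f g :
  (forall t, cube_boundary t -> f t = x) ->
  (forall t, cube_boundary t -> g t = x) ->
  forall t, cube_boundary t -> concat f g t = x.
Proof.
move=> fx gx t bt; rewrite /concat; case: ifPn => t0.
  apply: fx; apply: boundary_at0 => // -[e|e]; rewrite e.
    by left; rewrite val_zero mulr0 addr0.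
  by move: t0; rewrite e val_one; lra.
rewrite -ltNge in t0; apply: gx; apply: boundary_at0 => // -[e|e]; rewrite e.
  by move: t0; rewrite e val_zero; lra.
by right; rewrite val_one; congr clamp; lra.
Qed.

Lemma concat_based f g : based f -> based g -> based (concat f g).
Proof.
move=> [cf fx] [cg gx]; split; last exact: concat_boundary.
have cv : continuous (fun t : cube => uval (t ord0)).
  exact: continuous_scomp (@continuous_coord _ _ _) continuous_val_unit.
apply: paste_continuous => //.
- apply: (continuous_scomp _ cf); apply: continuous_at0; first by move=> ?.
  exact: continuous_aff.
- apply: (continuous_scomp _ cg); apply: continuous_at0; first by move=> ?.
  exact: continuous_aff.
- move=> t ->; rewrite divff ?pnatr_eq0// addr0 subrr.
  by rewrite fx ?gx//; apply: boundary_at0_end; [left|right].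
Qed.

Lemma reverse_based f : based f -> based (reverse f).
Proof.
move=> bf; apply: (@reparam_based (fun u => clamp (-1 * uval u + 1))) => //.
  by apply: continuous_aff; exact: continuous_val_unit.
move=> u [->|->]; [right|left].
  by rewrite val_zero mulr0 add0r.
by rewrite val_one mulr1 addNr.
Qed.

Lemma cst_based : based (fun=> x).
Proof. by split=> //; exact: (@cts_fun _ _ (cst x)). Qed.

Lemma concat_homotopic f f' g g' : based f -> based g ->
  homo f f' -> homo g g' -> homo (concat f g) (concat f' g').
Proof.
move=> bf bg [H [cH H0 H1 HA]] [K [cK K0 K1 KA]].
have [[cf fx] [cg gx]] := (bf, bg).
exists (fun p => concat (fun t => H (t, p.2)) (fun t => K (t, p.2)) p.1); split.
- have cv := @continuous_vfst R n.+1 I ord0.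
  have cfst : continuous (fst : cube * I -> cube) by move=> ?; exact: cvg_fst.
  apply: paste_continuous => //.
  + apply: (continuous_scomp _ cH); apply: continuous_pair; last first.
      by move=> p; exact: cvg_snd.
    by apply: continuous_at0 => //; exact: continuous_aff.
  + apply: (continuous_scomp _ cK); apply: continuous_pair; last first.
      by move=> p; exact: cvg_snd.
    by apply: continuous_at0 => //; exact: continuous_aff.
  + move=> p ->; rewrite divff ?pnatr_eq0// addr0 subrr.
    have b0 : cube_boundary (at0 p.1 (clamp 0)) by apply: boundary_at0_end; left.
    have b1 : cube_boundary (at0 p.1 (clamp 1)) by apply: boundary_at0_end; right.
    by rewrite HA// KA// fx ?gx.
- by move=> t; rewrite /concat/= !H0 !K0.
- by move=> t; rewrite /concat/= !H1 !K1.
- move=> t u bt; rewrite (concat_boundary fx gx bt).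
  by apply: concat_boundary => // s bs; rewrite ?HA ?KA ?fx ?gx.
Qed.

Lemma reverse_homotopic f f' : homo f f' -> homo (reverse f) (reverse f').
Proof.
move=> [H [cH H0 H1 HA]].
exists (fun p => reverse (fun t => H (t, p.2)) p.1); split.
- apply: (continuous_scomp _ cH); apply: continuous_pair; last first.
    by move=> p; exact: cvg_snd.
  apply: continuous_at0; first by move=> ?; exact: cvg_fst.
  by apply: continuous_aff; exact: continuous_vfst.
- by move=> t; rewrite /reverse/= H0.
- by move=> t; rewrite /reverse/= H1.
- move=> t u bt; rewrite /reverse/= HA//; apply: boundary_at0 => //.
  move=> -[->|->]; [right|left]; first by rewrite val_zero mulr0 add0r.
  by rewrite val_one mulr1 addNr.
Qed.

Lemma concatL f g t u : uval u <= 2^-1 ->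
  concat f g (at0 t u) = f (at0 t (clamp (2 * uval u + 0))).
Proof. by move=> u2; rewrite /concat dfwithin u2 at0_at0. Qed.

Lemma concatR f g t u : 2^-1 < uval u ->
  concat f g (at0 t u) = g (at0 t (clamp (2 * uval u + -1))).
Proof. by move=> u2; rewrite /concat dfwithin leNgt u2 /= at0_at0. Qed.

Lemma concat_ext f f' : (forall t u, f (at0 t u) = f' (at0 t u)) -> f = f'.
Proof. by move=> ff'; apply/funext => t; rewrite -(at0K t). Qed.

Lemma reparamE phi f t u : reparam phi f (at0 t u) = f (at0 t (phi u)).
Proof. by rewrite /reparam dfwithin at0_at0. Qed.

Lemma reverseE f t u : reverse f (at0 t u) = f (at0 t (clamp (-1 * uval u + 1))).
Proof. by rewrite /reverse dfwithin at0_at0. Qed.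

Lemma reparam_id f : reparam id f = f.
Proof. by apply/funext => t; rewrite /reparam at0K. Qed.

Definition assoc_map (u : I) : I :=
  clamp (Num.min (Num.min (2 * uval u) (uval u + 4^-1)) (2^-1 * uval u + 2^-1)).

Lemma uval_assoc_map u : uval (assoc_map u) =
  if uval u <= 4^-1 then 2 * uval u
  else if uval u <= 2^-1 then uval u + 4^-1 else 2^-1 * uval u + 2^-1.
Proof.
have := unitP u; set r := uval u => /andP[r0 r1]; rewrite /assoc_map -/r.
case: (leP r 4^-1) => r4; last case: (leP r 2^-1) => r2.
- rewrite (_ : Num.min _ (r + _) = 2 * r); last by apply: min_l; lra.
  by rewrite (_ : Num.min _ _ = 2 * r) ?val_clamp//;
    [apply/andP; split; lra|apply: min_l; lra].
- rewrite (_ : Num.min _ (r + _) = r + 4^-1); last by apply: min_r; lra.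
  by rewrite (_ : Num.min _ _ = r + 4^-1) ?val_clamp//;
    [apply/andP; split; lra|apply: min_l; lra].
- rewrite (_ : Num.min _ (r + _) = r + 4^-1); last by apply: min_r; lra.
  by rewrite (_ : Num.min _ _ = 2^-1 * r + 2^-1) ?val_clamp//;
    [apply/andP; split; lra|apply: min_r; lra].
Qed.

Lemma continuous_assoc_map : continuous assoc_map.
Proof.
have cu := @continuous_val_unit R.
apply: (continuous_scomp _ continuous_clamp).
apply: continuous_minr; last exact: continuous_affine.
apply: continuous_minr.
  by under eq_fun do rewrite -[_ * _]addr0; exact: continuous_affine.
by under eq_fun do rewrite -[uval _]mul1r; exact: continuous_affine.
Qed.

Lemma concatA_homotopic f g h : based f -> based g -> based h ->
  homo (concat f (concat g h)) (concat (concat f g) h).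
Proof.
move=> bf bg bh; have bgh := concat_based bg bh; have bfgh := concat_based bf bgh.
have e0 : assoc_map zero = zero.
  by apply: uval_inj; rewrite uval_assoc_map !val_zero ifT ?mulr0//; lra.
have e1 : assoc_map one = one.
  apply: uval_inj; rewrite uval_assoc_map !val_one ifF; last first.
    by apply/negbTE; rewrite -ltNge; lra.
  rewrite ifF; last by apply/negbTE; rewrite -ltNge; lra.
  lra.
rewrite -[X in homo X _]reparam_id.
rewrite (_ : concat (concat f g) h = reparam assoc_map (concat f (concat g h))).
  apply: reparam_homotopic => //.
  - by move=> ?.
  - exact: continuous_assoc_map.
  - by move=> u [->|->].
apply: concat_ext => t u; rewrite reparamE.
have /andP[u0 u1] := unitP u; have uE := uval_assoc_map u.
have [u4|u4] := leP (uval u) 4^-1; last have [u2|u2] := leP (uval u) 2^-1.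
- rewrite u4 in uE; rewrite [LHS]concatL; last by lra.
  have v2 : uval (clamp (2 * uval u + 0)) = 2 * uval u.
    by rewrite val_clamp addr0//; apply/andP; split; lra.
  rewrite concatL ?v2; last by lra.
  by rewrite [RHS]concatL uE//; lra.
- rewrite ifF ?u2 in uE; last by apply/negbTE; rewrite -ltNge.
  rewrite [LHS]concatL//.
  have v2 : uval (clamp (2 * uval u + 0)) = 2 * uval u.
    by rewrite val_clamp addr0//; apply/andP; split; lra.
  rewrite concatR ?v2; last by lra.
  rewrite [RHS]concatR uE; last by lra.
  have v3 : uval (clamp (2 * (uval u + 4^-1) + -1)) = 2 * uval u - 2^-1.
    by rewrite val_clamp; [lra|apply/andP; split; lra].
  rewrite concatL v3; last by lra.
  by congr (g (at0 t (clamp _))); lra.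
- rewrite ifF in uE; last by apply/negbTE; rewrite -ltNge.
  rewrite ifF in uE; last by apply/negbTE; rewrite -ltNge.
  rewrite [LHS]concatR//.
  rewrite [RHS]concatR uE; last by lra.
  have v3 : uval (clamp (2 * (2^-1 * uval u + 2^-1) + -1)) = uval u.
    by rewrite val_clamp; [lra|apply/andP; split; lra].
  by rewrite concatR v3.
Qed.

Lemma concat1_homotopic f : based f -> homo (concat (fun=> x) f) f.
Proof.
move=> bf; rewrite -[X in homo _ X]reparam_id.
rewrite (_ : concat _ f = reparam (fun u => clamp (2 * uval u + -1)) f).
  apply: reparam_homotopic => //.
  - by apply: continuous_aff; exact: continuous_val_unit.
  - by move=> ?.
  - move=> u [->|->]; first by left; rewrite val_zero clamp_le0//; lra.
    by right; rewrite val_one; congr clamp; lra.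
  - move=> u [->|->]; first by rewrite val_zero clamp_le0//; lra.
    by rewrite val_one; congr clamp; lra.
apply: concat_ext => t u; rewrite reparamE.
have [u2|u2] := leP (uval u) 2^-1; last by rewrite concatR.
rewrite concatL// clamp_le0; last by lra.
by case: bf => _ ->//; apply: boundary_at0_end; left.
Qed.

Lemma homotopic_concat1 f : based f -> homo (concat f (fun=> x)) f.
Proof.
move=> bf; rewrite -[X in homo _ X]reparam_id.
rewrite (_ : concat f _ = reparam (fun u => clamp (2 * uval u + 0)) f).
  apply: reparam_homotopic => //.
  - by apply: continuous_aff; exact: continuous_val_unit.
  - by move=> ?.
  - move=> u [->|->]; first by left; rewrite val_zero mulr0 addr0.
    by right; rewrite val_one clamp_ge1//; lra.
  - move=> u [->|->]; first by rewrite val_zero mulr0 addr0.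
    by rewrite val_one clamp_ge1//; lra.
apply: concat_ext => t u; rewrite reparamE.
have [u2|u2] := leP (uval u) 2^-1; first by rewrite concatL.
rewrite concatR// clamp_ge1; last by lra.
by case: bf => _ ->//; apply: boundary_at0_end; right.
Qed.

Lemma reparam_end f u : based f -> endpoint u -> reparam (fun=> u) f = fun=> x.
Proof.
move=> [_ fx] eu; apply/funext => t.
by apply: fx; exact: boundary_at0_end.
Qed.

Lemma concatV_homotopic f : based f -> homo (concat (reverse f) f) (fun=> x).
Proof.
move=> bf; rewrite -(@reparam_end f one)//; last by right.
rewrite (_ : concat _ f = reparam (fun u => clamp
    (Num.max (-2 * uval u + 1) (2 * uval u + -1))) f).
  apply: reparam_homotopic => //.
  - apply: (continuous_scomp _ continuous_clamp).
    by apply: continuous_maxr; apply: continuous_affine;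
      exact: continuous_val_unit.
  - exact: (@cts_fun _ _ (cst _)).
  - move=> u [->|->]; right.
      by rewrite val_zero max_l; [congr clamp|]; lra.
    by rewrite val_one max_r; [congr clamp|]; lra.
  - move=> u [->|->].
      by rewrite val_zero max_l; [congr clamp|]; lra.
    by rewrite val_one max_r; [congr clamp|]; lra.
apply: concat_ext => t u; rewrite reparamE; have /andP[u0 u1] := unitP u.
have [u2|u2] := leP (uval u) 2^-1.
  rewrite concatL// reverseE val_clamp; last by apply/andP; split; lra.
  by rewrite max_l; [congr (f (at0 t (clamp _)))|]; lra.
by rewrite concatR// max_r//; lra.
Qed.

Lemma homotopic_concatV f : based f -> homo (concat f (reverse f)) (fun=> x).
Proof.
move=> bf; rewrite -(@reparam_end f zero)//; last by left.
rewrite (_ : concat f _ = reparam (fun u => clamp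
    (Num.min (2 * uval u + 0) (-2 * uval u + 2))) f).
  apply: reparam_homotopic => //.
  - apply: (continuous_scomp _ continuous_clamp).
    by apply: continuous_minr; apply: continuous_affine;
      exact: continuous_val_unit.
  - exact: (@cts_fun _ _ (cst _)).
  - move=> u [->|->]; left.
      by rewrite val_zero min_l; [congr clamp|]; lra.
    by rewrite val_one min_r; [congr clamp|]; lra.
  - move=> u [->|->].
      by rewrite val_zero min_l; [congr clamp|]; lra.
    by rewrite val_one min_r; [congr clamp|]; lra.
apply: concat_ext => t u; rewrite reparamE; have /andP[u0 u1] := unitP u.
have [u2|u2] := leP (uval u) 2^-1; first by rewrite concatL// min_l//; lra.
rewrite concatR// reverseE val_clamp; last by apply/andP; split; lra.
by rewrite min_r; [congr (f (at0 t (clamp _)))|]; lra.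
Qed.

Definition loop_of f (bf : based f) : loops := cube_loop bf.1 bf.2.

Definition loop_mul a b : loops := loop_of (concat_based (basedP a) (basedP b)).
Definition loop_inv a : loops := loop_of (reverse_based (basedP a)).
Definition loop_one : loops := loop_of cst_based.

Local Open Scope quotient_scope.

Definition loop_class a : HG := \pi_HG a.

Definition pi_mul (p q : HG) : HG := loop_class (loop_mul (repr p) (repr q)).
Definition pi_inv (p : HG) : HG := loop_class (loop_inv (repr p)).
Definition pi_one : HG := loop_class loop_one.

Lemma loop_classP a b :
  homo (\val a) (\val b) <-> loop_class a = loop_class b.
Proof.
split=> [ab|/eqP]; first by apply/eqP; rewrite eqquotE; exact/asboolP.
by rewrite eqquotE => /asboolP.
Qed.

Lemma repr_homotopic a : homo (\val (repr (loop_class a))) (\val a).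
Proof. by apply/loop_classP; exact: reprK. Qed.

Lemma loop_classW (P : HG -> Prop) : (forall a, P (loop_class a)) -> forall p, P p.
Proof. by move=> Pc p; rewrite -[p]reprK; exact: Pc. Qed.

Lemma pi_mulE a b : pi_mul (loop_class a) (loop_class b) = loop_class (loop_mul a b).
Proof.
apply/loop_classP; apply: concat_homotopic; try exact: repr_homotopic.
  exact: basedP.
exact: basedP.
Qed.

Lemma pi_invE a : pi_inv (loop_class a) = loop_class (loop_inv a).
Proof. by apply/loop_classP/reverse_homotopic/repr_homotopic. Qed.

Lemma pi_mulA : associative pi_mul.
Proof.
elim/loop_classW => a; elim/loop_classW => b; elim/loop_classW => c.
rewrite !pi_mulE; apply/loop_classP.
by apply: concatA_homotopic; exact: basedP.
Qed.

Lemma pi_mul1 : left_id pi_one pi_mul.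
Proof.
elim/loop_classW => a; rewrite pi_mulE; apply/loop_classP.
by apply: concat1_homotopic; exact: basedP.
Qed.

Lemma pi_1mul : right_id pi_one pi_mul.
Proof.
elim/loop_classW => a; rewrite pi_mulE; apply/loop_classP.
by apply: homotopic_concat1; exact: basedP.
Qed.

Lemma pi_mulV : left_inverse pi_one pi_inv pi_mul.
Proof.
elim/loop_classW => a; rewrite pi_invE pi_mulE; apply/loop_classP.
by apply: concatV_homotopic; exact: basedP.
Qed.

Lemma pi_Vmul : right_inverse pi_one pi_inv pi_mul.
Proof.
elim/loop_classW => a; rewrite pi_invE pi_mulE; apply/loop_classP.
by apply: homotopic_concatV; exact: basedP.
Qed.

HB.instance Definition _ := isGroup.Build HG
  pi_mulA pi_mul1 pi_1mul pi_mulV pi_Vmul.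

End homotopy_group_law.

Definition isomorphic_groups (G H : groupType) : Prop :=
  exists phi : {multiplicative G -> H}, bijective phi.

(* Main.v *)
(* Following a path [a] by the track of [L1] (lift what remains of [f1 a], and
   take the end point) joins [f1^s (f1 a)] to [a(1)] inside the fiber; prepending
   [L2 (g s, f1 a)] and the homotopy [f2^(g s) ~ g f1^s] to the image of this
   track under [g] turns [a] into a path [h a] of [S2] that ends at [g (a(1))].
   Symmetrically for [k].

   For homotopy groups, apply [h] to the paths that a cube in [S1] traces along
   its last coordinate.  This gives phi : pi_n(S1) -> pi_n(S2) with
   [f2 phi = f1], and phi is induced by [g] on the classes coming from the
   fiber.  The same construction gives phi' from [g'] and phi'' from [g] again,
   at the next base point.  Now let T : pi_n(S, s) -> pi_n(S, p s) be a
   homomorphism over [O] that is induced on the image of pi_n(F) by a map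
   [p ~ id].  A class killed by [f] comes from the fiber, where T is a change of
   base point, so T is bijective by a diagram chase.  Hence phi' phi and
   phi'' phi' are bijective, and so is phi. *)

Require Import Defs.
From HB Require Import structures.
From mathcomp Require Import all_boot all_order all_algebra.
From mathcomp Require Import all_classical all_reals topology normedtype.
From mathcomp Require Import homotopy.
From mathcomp Require Import lra.

Set Implicit Arguments.
Unset Strict Implicit.
Unset Printing Implicit Defensive.

Import Order.TTheory GRing.Theory Num.Theory.
Import numFieldNormedType.Exports.

Local Open Scope classical_set_scope.
Local Open Scope ring_scope.

(** * Continuity of projections, constants and maps into subspaces *)

Lemma continuous_fst (X Y : topologicalType) : continuous (@fst X Y).
Proof. by move=> ?; exact: cvg_fst. Qed.

Lemma continuous_snd (X Y : topologicalType) : continuous (@snd X Y).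
Proof. by move=> ?; exact: cvg_snd. Qed.

Lemma continuous_cst (X Y : topologicalType) (y : Y) : continuous (fun _ : X => y).
Proof. by move=> ?; exact: cvg_cst. Qed.

Lemma continuous_sub (X Y : topologicalType) (A : set Y) (f : X -> A) :
  continuous (fun x => \val (f x)) -> continuous f.
Proof. exact: (@continuous_comp_initial _ _ _ (set_val : A -> Y)). Qed.

Lemma continuous_sval (Y : topologicalType) (A : set Y) :
  continuous (fun y : A => \val y).
Proof. exact: (@initial_continuous _ _ (set_val : A -> Y)). Qed.

(** * Continuous families of paths: currying and evaluation *)

Section path_families.
Context {R : realType}.
Local Notation I := (unit_interval R).

Lemma unit_interval_compact : compact [set: I].
Proof.
rewrite (_ : [set: I] = clamp @` `[0, 1]%classic).
  apply: continuous_compact; last exact: segment_compact.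
  by apply: continuous_subspaceT; exact: continuous_clamp.
apply/seteqP; split=> // u _; exists (uval u); last exact: valK_clamp.
by rewrite /= in_itv/= unitP.
Qed.

Lemma unit_interval_hausdorff : hausdorff_space I.
Proof.
move=> u v uv; apply: uval_inj; apply: (@norm_hausdorff _ R) => A B nA nB.
have [w [/= Aw Bw]] := uv _ _ (continuous_val_unit nA) (continuous_val_unit nB).
by exists (uval w).
Qed.

Lemma unit_interval_locally_compact : locally_compact [set: I].
Proof.
move=> u _; exists setT; first by rewrite withinET; exact: filterT.
by split; [exact: unit_interval_compact|exact: closedT].
Qed.

Context {S : topologicalType}.

Lemma path_family_cts (T : topologicalType) (P : T * I -> S) (x : T) :
  continuous P -> continuous (fun v => P (x, v)).
Proof.
move=> cP; apply: (continuous_scomp _ cP).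
by apply: continuous_pair; [exact: continuous_cst|move=> ?].
Qed.

Definition path_family (T : topologicalType) (P : T * I -> S)
    (cP : continuous P) (x : T) : path_space R S :=
  mkcts (@path_family_cts T P x cP) : continuousType _ _.

Lemma path_familyE (T : topologicalType) (P : T * I -> S) (cP : continuous P) x v :
  path_family cP x v = P (x, v).
Proof. by []. Qed.

Lemma path_family_continuous (T : topologicalType) (P : T * I -> S)
  (cP : continuous P) : continuous (path_family cP).
Proof.
apply: (@continuous_comp_initial _ _ _
  (id : path_space R S -> {compact-open, I -> S})).
exact: (continuous_curry_fun cP).
Qed.

(** The interval is locally compact and Hausdorff, so evaluation is continuous for the compact-open
    topology. *)
Lemma eval_path_continuous (T : topologicalType) (a : T -> path_space R S)
  (u : T -> I) : continuous a -> continuous u -> continuous (fun x => a x (u x)).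
Proof.
move=> ca cu.
pose e (p : path_space R S * I) := p.1 p.2.
have ce : continuous e.
  rewrite (_ : e = uncurry (fun a : path_space R S => a : I -> S)); last first.
    by apply/funext => -[].
  apply: continuous_uncurry.
  - exact: unit_interval_locally_compact.
  - exact: unit_interval_hausdorff.
  - exact: (@initial_continuous _ _ (id : path_space R S -> {compact-open, I -> S})).
  - by move=> b; exact: cts_fun.
exact: (continuous_scomp (continuous_pair ca cu) ce).
Qed.

End path_families.

(** * Collars in the cube *)

Section collar.
Context {R : realType} (n : nat).
Local Notation I := (unit_interval R).
Local Notation cube := (cube R n.+1).

Lemma uval_aff (u : I) (a b : R) : 0 <= a * uval u + b <= 1 ->
  uval (clamp (a * uval u + b)) = a * uval u + b.
Proof. exact: val_clamp. Qed.

(** Twice the sup-norm distance from the centre of the cube, so that the boundary is the level set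
    1. *)
Definition center_dist (t : cube) : R := \big[Num.max/0]_i `|2 * uval (t i) + -1|.

Lemma center_dist_continuous : continuous center_dist.
Proof.
apply: continuous_big.
  apply: continuous_maxr; [exact: continuous_fst|exact: continuous_snd].
move=> i _; apply: (continuous_scomp _ (@norm_continuous _ R)).
apply: continuous_affine.
exact: continuous_scomp (@continuous_coord _ _ i) continuous_val_unit.
Qed.

Lemma center_dist_le1 (t : cube) : center_dist t <= 1.
Proof.
apply: bigmax_le => // i _; have /andP[u0 u1] := unitP (t i).
by rewrite ler_norml; apply/andP; split; lra.
Qed.

Lemma center_dist_boundary (t : cube) : cube_boundary t -> center_dist t = 1.
Proof.
move=> [i ti]; apply/eqP; rewrite eq_le center_dist_le1 /=.
apply: le_trans (le_bigmax _ _ i).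
by case: ti => ->; rewrite ?val_zero ?val_one ler_normr; apply/orP; [right|left]; lra.
Qed.

(** For c >= 0 this is the expansion by the factor 1 + c about the centre, clamped to the cube: it
    carries the concentric cube of edge 1 / (1 + c) onto the whole cube and the rest into the
    boundary. *)
Definition stretch (c : R) (t : cube) : cube :=
  fun i => clamp ((1 + c) * uval (t i) + - (c / 2)).

Lemma stretch_continuous (T : topologicalType) (c : T -> R) (q : T -> cube) :
  continuous c -> continuous q -> continuous (fun x => stretch (c x) (q x)).
Proof.
move=> cc cq; apply: continuous_cube => i.
apply: (continuous_scomp _ continuous_clamp) => x.
have cu : continuous (fun x => uval (q x i)).
  apply: (continuous_scomp _ continuous_val_unit).
  exact: continuous_scomp cq (@continuous_coord _ _ i).
apply: cvgD; first by apply: cvgM; [apply: cvgD; [exact: cvg_cst|exact: cc]|exact: cu].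
by apply: cvgN; apply: cvgM; [exact: cc|exact: cvg_cst].
Qed.

Lemma stretch0 t : stretch 0 t = t.
Proof.
apply/functional_extensionality_dep => i.
by rewrite /stretch addr0 mul1r mul0r oppr0 addr0 valK_clamp.
Qed.

Lemma stretch_endpoint c (t : cube) i : 0 <= c ->
  endpoint (t i) -> stretch c t i = t i.
Proof.
move=> c0 [ti|ti]; rewrite /stretch ti ?val_zero ?val_one.
  by rewrite clamp_le0//; lra.
by rewrite clamp_ge1//; lra.
Qed.

Lemma stretch_boundary c (t : cube) : 0 <= c -> cube_boundary t ->
  cube_boundary (stretch c t).
Proof. by move=> c0 [i ti]; exists i; rewrite stretch_endpoint. Qed.

(** Outside the open concentric cube of edge 1 / (1 + c) some coordinate is expanded to a value at
    or beyond an end of the interval, and [clamp] sends it to that end. *)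
Lemma stretch_collar c (t : cube) : 0 <= c -> 1 <= (1 + c) * center_dist t ->
  cube_boundary (stretch c t).
Proof.
move=> c0; apply: contraPP => nb; apply/negP; rewrite -ltNge.
have c1 : 0 < 1 + c by lra.
rewrite mulrC -ltr_pdivlMr// div1r.
apply: bigmax_lt; first by rewrite invr_gt0.
move=> i _; rewrite ltNge; apply/negP => ti; apply: nb; exists i.
move: ti; rewrite ler_normr -div1r !ler_pdivrMr// /stretch.
have /andP[u0 u1] := unitP (t i).
by case/orP => h; [right; rewrite clamp_ge1//|left; rewrite clamp_le0//]; nra.
Qed.

Definition mix (w a b : I) : I := clamp ((1 - uval w) * uval a + uval w * uval b).

Lemma mix0 a b : mix zero a b = a.
Proof. by rewrite /mix val_zero subr0 mul1r mul0r addr0 valK_clamp. Qed.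

Lemma mix1 a b : mix one a b = b.
Proof. by rewrite /mix val_one subrr mul1r mul0r add0r valK_clamp. Qed.

Lemma mixx w a : mix w a a = a.
Proof. by rewrite /mix -mulrDl subrK mul1r valK_clamp. Qed.

Lemma mix01 w : mix w zero one = w.
Proof. by rewrite /mix val_zero val_one mulr0 add0r mulr1 valK_clamp. Qed.

Lemma mix_continuous (T : topologicalType) (w a b : T -> I) : continuous w ->
  continuous a -> continuous b -> continuous (fun x => mix (w x) (a x) (b x)).
Proof.
move=> cw ca cb; apply: (continuous_scomp _ continuous_clamp) => x.
have cv (h : T -> I) : continuous h -> continuous (fun x => uval (h x)).
  by move=> ch; exact: continuous_scomp ch continuous_val_unit.
apply: cvgD; apply: cvgM; [|exact: cv|exact: cv|exact: cv].
by apply: cvgB; [exact: cvg_cst|exact: cv].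
Qed.

Context {X : topologicalType}.
Local Notation homo := (homotopic_rel R (@cube_boundary R n.+1)).
Implicit Types (a b f : cube -> X) (E : cube * I -> X).

(** The straight-line homotopy from [p] to [q] works: on the boundary one coordinate stays at an end
    point throughout, so the value of [f] remains [x]. *)
Lemma straight_homotopic x f (p q : cube -> cube) : based x f ->
  continuous p -> continuous q ->
  (forall t, cube_boundary t -> exists i, p t i = q t i /\ endpoint (p t i)) ->
  homo (f \o p) (f \o q).
Proof.
move=> [cf fx] cp cq pq.
exists (fun y => f (fun i => mix y.2 (p y.1 i) (q y.1 i))); split.
- apply: (continuous_scomp _ cf); apply: continuous_cube => i.
  have cc (h : cube -> cube) : continuous h ->
      continuous (fun y : cube * I => h y.1 i).
    move=> ch; have ch1 := continuous_scomp (@continuous_fst cube I) ch.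
    exact: continuous_scomp ch1 (@continuous_coord _ _ i).
  by apply: mix_continuous; [exact: continuous_snd|exact: cc|exact: cc].
- move=> t; congr f; apply/functional_extensionality_dep => i; exact: mix0.
- move=> t; congr f; apply/functional_extensionality_dep => i; exact: mix1.
- move=> t u /pq [i [pqi ei]]; rewrite /= !fx//; first by exists i.
  by exists i; rewrite -pqi mixx.
Qed.

Lemma stretch_homotopic x f c : 0 <= c -> based x f -> homo (f \o stretch c) f.
Proof.
move=> c0 bf; rewrite [X in homo _ X](_ : f = f \o id)//.
apply: (straight_homotopic bf) => [||t [i ti]]; last 1 first.
- by exists i; rewrite stretch_endpoint.
- by apply: stretch_continuous; [exact: continuous_cst|move=> ?].
- by move=> ?.
Qed.

(** A free homotopy whose restriction to the boundary is prescribed by [E]. If [E] follows a path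
    independently of the position, this is a change of base point; if [E] is constant, it is a
    homotopy relative to the boundary. *)
Definition transports E a b := exists H : cube * I -> X,
  [/\ continuous H, forall t, H (t, zero) = a t, forall t, H (t, one) = b t
    & forall t u, cube_boundary t -> H (t, u) = E (t, u)].

(* [a] is shrunk to the concentric cube of edge [1 / (1 + c)], and the collar
   around it is filled with [E]. *)
Definition collar c a E t : X :=
  if (1 + c) * center_dist t + 0 <= 1 then a (stretch c t)
  else E (stretch c t, clamp ((1 + c) * center_dist t + -1)).

Lemma collar_boundary c a E t : 0 < c <= 1 -> cube_boundary t ->
  collar c a E t = E (stretch c t, clamp c).
Proof.
move=> /andP[c0 c1] bt; rewrite /collar (center_dist_boundary bt) ifF; last first.
  by apply/negbTE; rewrite -ltNge; lra.
by congr (E (_, clamp _)); lra.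
Qed.

(** All data depend on a parameter in [T], so that homotopies of collars are covered too. The two
    formulas agree where they meet because [stretch] sends that locus to the boundary, where [A] is
    [E] at time 0. *)
Lemma collar_continuous (T : topologicalType) (c : T -> R) (A : cube * T -> X)
    (E : cube * T -> I -> X) (q : T -> cube) :
  continuous c -> (forall x, 0 <= c x) -> continuous q -> continuous A ->
  continuous (fun p : (cube * T) * I => E p.1 p.2) ->
  (forall t x, cube_boundary t -> A (t, x) = E (t, x) zero) ->
  continuous (fun x =>
    collar (c x) (fun t => A (t, x)) (fun p => E (p.1, x) p.2) (q x)).
Proof.
move=> cc c0 cq cA cE AE.
have cr : continuous (fun x => (1 + c x) * center_dist (q x)).
  move=> x; apply: cvgM; first by apply: cvgD; [exact: cvg_cst|exact: cc].
  exact: (continuous_scomp cq center_dist_continuous).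
have cs := stretch_continuous cc cq.
have cid : continuous (fun x : T => x) by move=> ?.
rewrite /collar; apply: paste_continuous.
- by move=> x; apply: cvgD; [exact: cr|exact: cvg_cst].
- exact: (continuous_scomp (continuous_pair cs cid) cA).
- apply: (continuous_scomp (f := fun x =>
    ((stretch (c x) (q x), x), clamp ((1 + c x) * center_dist (q x) + -1))) _ cE).
  apply: continuous_pair; first exact: continuous_pair.
  apply: (continuous_scomp _ continuous_clamp) => x.
  by apply: cvgD; [exact: cr|exact: cvg_cst].
- move=> x; rewrite addr0 => rx; rewrite rx subrr; apply: AE.
  by apply: stretch_collar; rewrite ?rx.
Qed.

End collar.

(** * Existence and uniqueness of transport along prescribed boundary values *)

Section transport.
Context {R : realType} (n : nat).
Local Notation I := (unit_interval R).
Local Notation cube := (cube R n.+1).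
Local Notation homo := (homotopic_rel R (@cube_boundary R n.+1)).

Definition flip (u : I) : I := clamp (-1 * uval u + 1).

Lemma flip0 : flip zero = one.
Proof. by rewrite /flip val_zero mulr0 add0r. Qed.

Lemma flip1 : flip one = zero.
Proof. by rewrite /flip val_one mulr1 addNr. Qed.

Lemma flip_continuous : continuous flip.
Proof. by apply: continuous_aff; exact: continuous_val_unit. Qed.

Lemma uval_flip u : uval (flip u) = 1 - uval u.
Proof.
by have /andP[u0 u1] := unitP u; rewrite /flip uval_aff; [|apply/andP; split]; lra.
Qed.

Context {X : topologicalType} (x : X).
Implicit Types (a b f : cube -> X) (E : cube * I -> X).

(* The collar of [a] has thickness [0] at time [0]; stretching moves the points of
   the boundary, so that there the homotopy follows [E] only up to [stretch]. *)
Lemma transports_exist E a : continuous E -> continuous a ->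
  (forall t, cube_boundary t -> a t = E (t, zero)) ->
  (forall t, E (t, one) = x) ->
  exists b, based x b /\
    transports (fun p => E (stretch (uval p.2) p.1, p.2)) a b.
Proof.
move=> cE ca aE E1.
have u0 (u : I) : 0 <= uval u by have /andP[] := unitP u.
have cH : continuous (fun p : cube * I => collar (uval p.2) a E p.1).
  apply: (@collar_continuous _ _ _ _ (fun p => uval p.2) (fun p => a p.1)
    (fun p u => E (p.1, u)) fst).
  - exact: continuous_vsnd.
  - by move=> p; exact: u0.
  - exact: continuous_fst.
  - exact: continuous_scomp (@continuous_fst _ _) ca.
  - apply: (continuous_scomp _ cE); apply: continuous_pair.
      exact: continuous_scomp (@continuous_fst _ _) (@continuous_fst _ _).
    exact: continuous_snd.
  - by move=> t p bt; exact: aE.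
have one01 : 0 < (1 : R) <= 1 by apply/andP; split; lra.
exists (collar 1 a E); split.
  split; last by move=> t bt; rewrite collar_boundary// E1.
  have ct : continuous (fun t : cube => (t, one : I)).
    by apply: continuous_pair; [move=> ?|exact: continuous_cst].
  by have := continuous_scomp ct cH; rewrite /= val_one.
exists (fun p => collar (uval p.2) a E p.1); split => //.
- move=> t; rewrite /collar val_zero stretch0 !addr0 mul1r ifT//.
  exact: center_dist_le1.
- by move=> t; rewrite val_one.
- move=> t u bt /=; have := u0 u; rewrite le_eqVlt => /orP[/eqP u0'|uu].
    have -> : u = zero by apply: uval_inj; rewrite val_zero.
    by rewrite val_zero /collar stretch0 !addr0 mul1r ifT ?center_dist_le1// aE.
  rewrite collar_boundary ?valK_clamp//.
  by rewrite uu; have /andP[] := unitP u.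
Qed.

Let one01 : 0 < (1 : R) <= 1. Proof. by apply/andP; split; lra. Qed.

(** After [b] is replaced by its composite with [stretch 1], the transport is unwound: at time u the
    inner cube carries [H] at time 1 - u and the collar follows [E] from time 1 - u on. At the start
    the collar is constant at [x]; at the end it is the full collar around [a]. *)
Lemma collar_transported E a b : continuous E -> (forall t, E (t, one) = x) ->
  transports E a b -> homo b (collar 1 a E).
Proof.
move=> cE E1 [H [cH H0 H1 HE]].
have bb : based x b.
  split; last by move=> t bt; rewrite -H1 HE.
  rewrite (_ : b = fun t => H (t, one)); last by apply/funext => t; rewrite H1.
  apply: (continuous_scomp _ cH); apply: continuous_pair; last exact: continuous_cst.
  by move=> ?.
apply: homotopic_rel_trans.
  by apply/homotopic_rel_sym; exact: (stretch_homotopic ler01 bb).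
pose later (u v : I) := clamp (Num.max (1 - uval u) (uval v)).
exists (fun p => collar 1 (fun t => H (t, flip p.2))
  (fun q => E (q.1, later p.2 q.2)) p.1); split.
- apply: (@collar_continuous _ _ _ _ (fun=> 1) (fun p => H (p.1, flip p.2.2))
    (fun p v => E (p.1, later p.2.2 v)) fst).
  + exact: continuous_cst.
  + by move=> _; exact: ler01.
  + exact: continuous_fst.
  + apply: (continuous_scomp _ cH); apply: continuous_pair; first exact: continuous_fst.
    apply: (continuous_scomp _ flip_continuous).
    exact: continuous_scomp (@continuous_snd _ _) (@continuous_snd _ _).
  + apply: (continuous_scomp _ cE); apply: continuous_pair.
      exact: continuous_scomp (@continuous_fst _ _) (@continuous_fst _ _).
    apply: (continuous_scomp _ continuous_clamp).
    apply: continuous_maxr; last exact: continuous_vsnd.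
    have cu : continuous (fun p : cube * (cube * I) * I => uval p.1.2.2).
      apply: (continuous_scomp _ continuous_val_unit).
      apply: (continuous_scomp _ (@continuous_snd _ _)).
      exact: continuous_scomp (@continuous_fst _ _) (@continuous_snd _ _).
    by move=> p; apply: cvgB; [exact: cvg_cst|exact: cu].
  + move=> t p bt /=; rewrite HE//; congr (E (t, _)); apply: uval_inj.
    rewrite uval_flip /later val_zero max_l; last first.
      by have /andP[] := unitP p.2; lra.
    by rewrite val_clamp//; have /andP[] := unitP p.2; move=> *; apply/andP; split; lra.
- move=> t; rewrite /collar flip0 H1; case: ifPn => //.
  rewrite -ltNge addr0 => /ltW rt /=.
  rewrite (bb.2 (stretch 1 t)); last exact: stretch_collar.
  rewrite /later val_zero subr0 clamp_ge1 ?E1// le_max; apply/orP; left; lra.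
- move=> t; rewrite /collar flip1 H0; case: ifPn => // _.
  congr (E (_, _)); rewrite /later val_one subrr max_r ?valK_clamp//.
  by have /andP[] := unitP (clamp ((1 + 1) * center_dist t + -1)).
- move=> t u bt; rewrite collar_boundary//= (bb.2 (stretch 1 t)); last first.
    exact: stretch_boundary.
  rewrite /later clamp_ge1 ?E1//.
  by rewrite le_max; apply/orP; right; rewrite val_clamp; [lra|apply/andP; split; lra].
Qed.

(** Each result is homotopic to the collar around its source, and a homotopy between the sources
    that fixes the boundary can be performed in the inner cube. *)
Lemma transports_unique E a a' b b' : continuous E ->
  (forall t, E (t, one) = x) -> homo a a' ->
  transports E a b -> transports E a' b' -> homo b b'.
Proof.
move=> cE E1 [K [cK K0 K1 KA]] ab a'b'; apply: homotopic_rel_trans.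
  exact: (collar_transported cE E1 ab).
apply/homotopic_rel_sym/(homotopic_rel_trans (collar_transported cE E1 a'b')).
apply/homotopic_rel_sym; have [H [cH H0 _ HE]] := ab.
exists (fun p => collar 1 (fun t => K (t, p.2)) E p.1); split.
- rewrite (_ : (fun p => _) = (fun p : cube * I => collar 1 (fun t => K (t, p.2))
    (fun q => E (q.1, q.2)) p.1)); last first.
    by apply/funext => p; congr collar; apply/funext => -[].
  apply: (@collar_continuous _ _ _ _ (fun=> 1) (fun p => K (p.1, p.2.2))
    (fun p v => E (p.1, v)) fst).
  + exact: continuous_cst.
  + by move=> _; exact: ler01.
  + exact: continuous_fst.
  + apply: (continuous_scomp _ cK); apply: continuous_pair; first exact: continuous_fst.
    exact: continuous_scomp (@continuous_snd _ _) (@continuous_snd _ _).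
  + apply: (continuous_scomp _ cE); apply: continuous_pair.
      exact: continuous_scomp (@continuous_fst _ _) (@continuous_fst _ _).
    exact: continuous_snd.
  + by move=> t p bt /=; rewrite KA// -H0 HE.
- by move=> t; congr collar; apply/funext => s; rewrite K0.
- by move=> t; congr collar; apply/funext => s; rewrite K1.
- by move=> t u bt; rewrite !collar_boundary//= E1 E1.
Qed.

Lemma transports_homotopic a b : transports (fun=> x) a b ->
  homo a b.
Proof.
move=> [H [cH H0 H1 HE]]; exists H; split=> // t u bt.
by rewrite HE// -H0 HE.
Qed.

Lemma transports_rev E a b : transports E a b ->
  transports (fun p => E (p.1, flip p.2)) b a.
Proof.
move=> [H [cH H0 H1 HE]]; exists (fun p => H (p.1, flip p.2)); split.
- apply: (continuous_scomp _ cH); apply: continuous_pair; first exact: continuous_fst.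
  exact: continuous_scomp (@continuous_snd _ _) flip_continuous.
- by move=> t; rewrite flip0.
- by move=> t; rewrite flip1.
- by move=> t u bt; rewrite HE.
Qed.

(** Concatenation rescales the first coordinate, hence the demand that [E] ignore it. Then both
    homotopies also take the same values on the common wall. *)
Lemma transports_concat E a a' b b' :
  (forall t v u, E (dfwith t ord0 v : cube, u) = E (t, u)) ->
  transports E a b -> transports E a' b' ->
  transports E (concat a a') (concat b b').
Proof.
move=> E0 [H [cH H0 H1 HE]] [H' [cH' H0' H1' HE']].
exists (fun p => concat (fun t => H (t, p.2)) (fun t => H' (t, p.2)) p.1); split.
- have cv := @continuous_vfst R n.+1 I ord0.
  have cfst := @continuous_fst cube I.
  apply: paste_continuous => //.
  + apply: (continuous_scomp _ cH); apply: continuous_pair; last exact: continuous_snd.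
    by apply: continuous_at0 => //; exact: continuous_aff.
  + apply: (continuous_scomp _ cH'); apply: continuous_pair; last exact: continuous_snd.
    by apply: continuous_at0 => //; exact: continuous_aff.
  + move=> p ->; rewrite divff ?pnatr_eq0// addr0 subrr.
    have b0 : cube_boundary (dfwith p.1 ord0 (clamp 0) : cube).
      by apply: boundary_at0_end; left.
    have b1 : cube_boundary (dfwith p.1 ord0 (clamp 1) : cube).
      by apply: boundary_at0_end; right.
    by rewrite HE// HE'// !E0.
- by move=> t; rewrite /concat/= !H0 !H0'.
- by move=> t; rewrite /concat/= !H1 !H1'.
- move=> t u bt /=; rewrite /concat; case: ifPn => t0.
    rewrite HE ?E0//; apply: boundary_at0 => // -[e|e]; rewrite e.
      by left; rewrite val_zero mulr0 addr0.
    by move: t0; rewrite e val_one; lra.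
  rewrite -ltNge in t0; rewrite HE' ?E0//; apply: boundary_at0 => // -[e|e]; rewrite e.
    by move: t0; rewrite e val_zero; lra.
  by right; rewrite val_one; congr clamp; lra.
Qed.

End transport.

Lemma transports_map (R : realType) (n : nat) (X Y : topologicalType)
  (f : X -> Y) E (a b : cube R n.+1 -> X) : continuous f -> transports E a b ->
  transports (f \o E) (f \o a) (f \o b).
Proof.
move=> cf [H [cH H0 H1 HE]]; exists (f \o H); split.
- exact: continuous_scomp cH cf.
- by move=> t /=; rewrite H0.
- by move=> t /=; rewrite H1.
- by move=> t u bt /=; rewrite HE.
Qed.

Lemma homotopic_rel_map (R : realType) (Z X Y : topologicalType) (A : set Z)
  (f : X -> Y) (a b : Z -> X) : continuous f -> homotopic_rel R A a b ->
  homotopic_rel R A (f \o a) (f \o b).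
Proof.
move=> cf [H [cH H0 H1 HA]]; exists (f \o H); split.
- exact: continuous_scomp cH cf.
- by move=> t /=; rewrite H0.
- by move=> t /=; rewrite H1.
- by move=> t u At /=; rewrite HA.
Qed.

(** * Lifting functions applied to continuous families of paths *)

Section lifting_families.
Context {R : realType} {S O : topologicalType} (f : continuousType S O).
Local Notation I := (unit_interval R).

(** The last clause identifies each lifted path with the value of [L] at any pair having the same
    starting point and the same path, whatever its proof of membership. It is through this clause
    that end points of lifts become values of [Lf_restriction]. *)
Lemma lift_family (L : lifting_function R f) (T : topologicalType) (x : T -> S)
    (a : T * I -> O) : continuous x -> continuous a ->
  (forall t, f (x t) = a (t, zero)) ->
  exists P : T * I -> S, [/\ continuous P, forall t, P (t, zero) = x t,
    forall t v, f (P (t, v)) = a (t, v)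
  & forall t s (b : path_space R O) (fsb : f s = b zero), s = x t ->
      (forall v, b v = a (t, v)) -> forall v, P (t, v) = L (lifting_pair fsb) v].
Proof.
move=> cx ca fxa.
pose q t : lifting_domain f := @lifting_pair R S O f (x t) (path_family ca t) (fxa t).
have cq : continuous q.
  apply: continuous_sub; apply: continuous_pair => //.
  exact: path_family_continuous.
have cL := continuous_scomp cq (@lift_path_continuous _ _ _ _ L).
exists (fun p => L (q p.1) p.2); split.
- apply: eval_path_continuous; last exact: continuous_snd.
  exact: continuous_scomp (@continuous_fst _ _) cL.
- by move=> t; rewrite lift_path_zero.
- by move=> t v; have := congr1 (fun b : path_space R O => b v) (lift_pathK L (q t)).
- move=> t s b fsb sx ba v /=.
  rewrite (_ : q t = lifting_pair fsb)//; apply: val_inj => /=.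
  by congr pair; [rewrite sx|apply/continuousEP => w; rewrite ba].
Qed.

Lemma lift_const_path (L : lifting_function R f) (s : S) (b : path_space R O)
    (fsb : f s = b zero) : regular L -> (forall v, b v = f s) ->
  forall v, L (lifting_pair fsb) v = s.
Proof.
move=> rL bs v; rewrite (_ : lifting_pair fsb =
  @lifting_pair R S O f s (comp_path f (const_path R s)) (erefl _)) ?rL//.
by apply: val_inj; congr pair; apply/continuousEP => w; rewrite bs.
Qed.

Lemma lift_family_regular (L : lifting_function R f) (T : topologicalType)
    (x : T -> S) (a : T * I -> O) : regular L -> continuous x -> continuous a ->
  (forall t, f (x t) = a (t, zero)) ->
  exists P : T * I -> S, [/\ continuous P, forall t, P (t, zero) = x t,
    forall t v, f (P (t, v)) = a (t, v),
    forall t s (b : path_space R O) (fsb : f s = b zero), s = x t ->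
      (forall v, b v = a (t, v)) -> forall v, P (t, v) = L (lifting_pair fsb) v
  & forall t, (forall v, a (t, v) = f (x t)) -> forall v, P (t, v) = x t].
Proof.
move=> rL cx ca fxa; have [P [cP P0 fP PL]] := lift_family L cx ca fxa.
exists P; split=> // t at_ v.
rewrite (PL t (x t) (path_family ca t) (fxa t))//.
by apply: lift_const_path.
Qed.

Lemma loop_family (T : topologicalType) (r : O) (a : T * I -> O) : continuous a ->
  (forall t, a (t, zero) = r) -> (forall t, a (t, one) = r) ->
  exists l : T -> loop_space R r,
    continuous l /\ forall t v, (l t : I -> O) v = a (t, v).
Proof.
move=> ca a0 a1.
exists (fun t => mk_path (@path_family_cts R O T a t ca) (a0 t) (a1 t)
  : {path I from r to r in O}); split=> //.
apply: (@continuous_comp_initial _ _ _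
  (id : {path I from r to r in O} -> {compact-open, I -> O})).
exact: (continuous_curry_fun ca).
Qed.

End lifting_families.

(** * Concatenation of families of paths *)

Section chain.
Context {R : realType} {T X : topologicalType}.
Local Notation I := (unit_interval R).
Implicit Types P Q : T * I -> X.

Definition dbl (u : I) : I := clamp (2 * uval u + 0).
Definition dbl1 (u : I) : I := clamp (2 * uval u + -1).

Lemma dbl0 : dbl zero = zero.
Proof. by rewrite /dbl val_zero mulr0 addr0. Qed.

Lemma dbl_one : dbl one = one.
Proof. by rewrite /dbl val_one clamp_ge1//; lra. Qed.

Lemma dbl1_zero : dbl1 zero = zero.
Proof. by rewrite /dbl1 val_zero clamp_le0//; lra. Qed.

Lemma dbl1_one : dbl1 one = one.
Proof. by rewrite /dbl1 val_one; congr clamp; lra. Qed.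

Lemma dbl_continuous : continuous dbl.
Proof. by apply: continuous_aff; exact: continuous_val_unit. Qed.

Lemma dbl1_continuous : continuous dbl1.
Proof. by apply: continuous_aff; exact: continuous_val_unit. Qed.

Definition chain P Q (p : T * I) : X :=
  if uval p.2 <= 2^-1 then P (p.1, dbl p.2) else Q (p.1, dbl1 p.2).

Lemma chain_continuous P Q : continuous P -> continuous Q ->
  (forall t, P (t, one) = Q (t, zero)) -> continuous (chain P Q).
Proof.
move=> cP cQ PQ.
have cd (d : I -> I) : continuous d -> continuous (fun p : T * I => (p.1, d p.2)).
  move=> cd; apply: continuous_pair; first exact: continuous_fst.
  exact: continuous_scomp (@continuous_snd _ _) cd.
apply: paste_continuous; first exact: continuous_vsnd.
- exact: continuous_scomp (cd _ dbl_continuous) cP.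
- exact: continuous_scomp (cd _ dbl1_continuous) cQ.
- by move=> p p2; rewrite /dbl /dbl1 p2 divff ?pnatr_eq0// addr0 subrr PQ.
Qed.

Lemma chain0 P Q t : chain P Q (t, zero) = P (t, zero).
Proof. by rewrite /chain val_zero dbl0 ifT//; lra. Qed.

Lemma chain1 P Q t : chain P Q (t, one) = Q (t, one).
Proof. by rewrite /chain val_one dbl1_one ifF//; apply/negbTE; rewrite -ltNge; lra. Qed.

(** Since [dbl] rests at 1 on the second half, a constant second path is absorbed into a
    reparametrization of the first. *)
Lemma chain_cst P Q t : (forall v, Q (t, v) = P (t, one)) ->
  forall v, chain P Q (t, v) = P (t, dbl v).
Proof.
move=> QP v; rewrite /chain /=; case: ifPn => // v2; rewrite QP; congr (P (_, _)).
by rewrite /dbl clamp_ge1//; move: v2; rewrite -ltNge; lra.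
Qed.

End chain.

Lemma chain_map (R : realType) (T X Y : topologicalType) (f : X -> Y)
    (P Q : T * unit_interval R -> X) p :
  f (chain P Q p) = chain (f \o P) (f \o Q) p.
Proof. by rewrite /chain; case: ifP. Qed.

(** * Homotopy classes and their representatives *)

Section representatives.
Context {R : realType} (n : nat) {X : topologicalType} {x : X}.
Local Notation homo := (homotopic_rel R (@cube_boundary R n.+1)).
Implicit Types (c d : homotopy_group R n.+1 x) (a b : cube R n.+1 -> X).

(** A relation between classes and plain maps on the cube: arguments can then use any convenient
    representative instead of the one chosen by the quotient. *)
Definition represents c a := exists ba : based x a, c = loop_class (loop_of ba).

Lemma represents_based c a : represents c a -> based x a.
Proof. by case. Qed.

Lemma represents_exists c : exists a, represents c a.
Proof.
move: c; apply: loop_classW => a; exists (\val a), (basedP a).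
by congr loop_class; apply: val_inj => /=; apply/continuousEP.
Qed.

Lemma based_represents a : based x a -> exists c, represents c a.
Proof. by move=> ba; exists (loop_class (loop_of ba)), ba. Qed.

Lemma represents_homotopic c a b : represents c a -> represents c b -> homo a b.
Proof. by move=> [ba ->] [bb /loop_classP]. Qed.

Lemma homotopic_represents c a b : represents c a -> based x b -> homo a b ->
  represents c b.
Proof. by move=> [ba ->] bb ab; exists bb; apply/loop_classP. Qed.

Lemma represents_inj c d a : represents c a -> represents d a -> c = d.
Proof.
move=> [ba ->] [bb ->]; apply/loop_classP.
exact: homotopic_rel_refl ba.1.
Qed.

Lemma represents_mul c d a b : represents c a -> represents d b ->
  represents (c * d)%g (concat a b).
Proof.
move=> [ba ->] [bb ->]; exists (concat_based ba bb); rewrite [LHS]pi_mulE.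
by apply/loop_classP; exact/homotopic_rel_refl/(concat_based ba bb).1.
Qed.

Lemma represents_inv c a : represents c a -> represents c^-1%g (reverse a).
Proof.
move=> [ba ->]; exists (reverse_based ba); rewrite [LHS]pi_invE.
by apply/loop_classP; exact/homotopic_rel_refl/(reverse_based ba).1.
Qed.

Lemma represents_one : represents 1%g (fun=> x).
Proof. by exists (cst_based n x). Qed.

End representatives.

(** The relation may be multivalued: compatibility with homotopy makes the class of [b] independent
    of all choices, and compatibility with concatenation makes the resulting map a homomorphism. *)
Lemma multiplicative_of_representatives (R : realType) (n : nat)
    (X Y : topologicalType) (x : X) (y : Y)
    (rel : (cube R n.+1 -> X) -> (cube R n.+1 -> Y) -> Prop) :
  (forall a, based x a -> exists2 b, based y b & rel a b) ->
  (forall a a' b b', based x a -> based x a' -> rel a b -> rel a' b' ->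
    homotopic_rel R (@cube_boundary R n.+1) a a' ->
    homotopic_rel R (@cube_boundary R n.+1) b b') ->
  (forall a a' b b', based x a -> based x a' -> rel a b -> rel a' b' ->
    rel (concat a a') (concat b b')) ->
  exists phi : {multiplicative homotopy_group R n.+1 x -> homotopy_group R n.+1 y},
    forall c a b, represents c a -> based y b -> rel a b -> represents (phi c) b.
Proof.
move=> rel_ex rel_homo rel_mul.
have phiP (c : homotopy_group R n.+1 x) : exists d : homotopy_group R n.+1 y,
    forall a b, represents c a -> based y b -> rel a b -> represents d b.
  have [a ca] := represents_exists c.
  have [b bb ab] := rel_ex a (represents_based ca).
  have [d db] := based_represents bb; exists d => a' b' ca' bb' ab'.
  apply: (homotopic_represents db bb').
  apply: (rel_homo _ _ _ _ _ _ ab ab'); first exact: represents_based ca.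
    exact: represents_based ca'.
  exact: represents_homotopic ca ca'.
pose phi (c : homotopy_group R n.+1 x) := sval (cid (phiP c)).
have phiE c a b : represents c a -> based y b -> rel a b -> represents (phi c) b.
  exact: (svalP (cid (phiP c))).
have phiM : {morph phi : c d / (c * d)%g}.
  move=> c d; have [a ca] := represents_exists c; have [b db] := represents_exists d.
  have [ba bb] := (represents_based ca, represents_based db).
  have [a' ba' aa'] := rel_ex a ba; have [b' bb' bb''] := rel_ex b bb.
  apply: (@represents_inj _ _ _ _ _ _ (concat a' b')).
    apply: phiE; [exact: represents_mul ca db|exact: concat_based|exact: rel_mul].
  by apply: represents_mul; [exact: phiE ca ba' aa'|exact: phiE db bb' bb''].
pose Phi : {multiplicative homotopy_group R n.+1 x -> homotopy_group R n.+1 y} :=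
  HB.pack phi (isMultiplicative.Build _ _ phi phiM).
by exists Phi.
Qed.

Lemma multiplicative_bijective (G H : groupType) (T : {multiplicative G -> H}) :
  (forall x, T x = 1%g -> x = 1%g) -> (forall y, exists x, T x = y) -> bijective T.
Proof.
move=> Tker Tsurj.
have T1 : T 1%g = 1%g by apply: (@mulgI _ (T 1%g)); rewrite -gmulfM !mulg1.
have Tinj : injective T.
  move=> x y xy; apply/divg1_eq/Tker.
  by rewrite gmulfM xy -gmulfM mulgV.
exists (fun y => sval (cid (Tsurj y))) => x; last exact: svalP (cid (Tsurj x)).
apply: Tinj; exact: svalP (cid (Tsurj (T x))).
Qed.

(** * Change of base point along a path *)

Section basepoint.
Context {R : realType} (n : nat) {X : topologicalType}.
Local Notation I := (unit_interval R).
Local Notation cube := (cube R n.+1).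

(** The boundary moves along [q] in the same way at every point, so the stretching of the position
    in [transports_exist] has no effect. *)
Lemma transports_path_exist (q : I -> X) (a : cube -> X) : continuous q ->
  based (q zero) a -> exists b, based (q one) b /\ transports (q \o snd) a b.
Proof.
move=> cq [ca ax]; have := @transports_exist R n X (q one) (q \o snd) a.
apply => //; exact: (continuous_scomp (@continuous_snd _ _) cq).
Qed.

Lemma transports_path_cst (q : I -> X) : continuous q ->
  transports (q \o snd) (fun _ : cube => q zero) (fun=> q one).
Proof.
move=> cq; exists (q \o snd); split=> //.
exact: (continuous_scomp (@continuous_snd _ _) cq).
Qed.

End basepoint.

Lemma based_map (R : realType) (n : nat) (X Y : topologicalType) (f : X -> Y) x
  (a : cube R n.+1 -> X) : continuous f -> based x a -> based (f x) (f \o a).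
Proof.
by move=> cf [ca ax]; split=> [|t /ax /= ->//]; exact: continuous_scomp ca cf.
Qed.

(** * Endomorphisms over the base that come from a self-map of the fiber homotopic to the
    identity *)

Section fiber_action.
Context {R : realType} (n : nat) {S O : topologicalType}.
Context (f : continuousType S O) (L : lifting_function R f) (rL : regular L).
Context (r : O).
Local Notation F := (fiber f r).
Local Notation I := (unit_interval R).
Local Notation cube := (cube R n.+1).
Local Notation homo := (homotopic_rel R (@cube_boundary R n.+1)).
Local Notation incl := (fun z : F => \val z).

Lemma fiberE (z : F) : f (\val z) = r.
Proof. exact: (set_mem (valP z)). Qed.

(** This is exactness of the homotopy sequence at the total space. The null homotopy of [f \o a] is
    lifted starting from [a]; it is stationary over the boundary, so by regularity the lift is too,
    and it ends in the fiber. *)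
Lemma deform_into_fiber (s : F) (a : cube -> S) : based (\val s) a ->
  homo (f \o a) (fun=> r) -> exists2 y : cube -> F, based s y & homo a (incl \o y).
Proof.
move=> [ca as_] [K [cK K0 K1 KA]].
have [P [cP P0 fP _ Pcst]] := lift_family_regular rL ca cK (fun t => esym (K0 t)).
have PF t : F (P (t, one)) by rewrite /fiber/= fP K1.
have PA t u : cube_boundary t -> P (t, u) = a t.
  by move=> bt; apply: Pcst => v; rewrite KA.
pose y t : F := SigSub (mem_set (PF t)).
exists y; last by exists P.
split; last by move=> t bt; apply: val_inj; rewrite /= PA// as_.
apply: continuous_sub; apply: (continuous_scomp _ cP).
by apply: continuous_pair; [move=> ?|exact: continuous_cst].
Qed.

(** On classes from the fiber, transport along the track of [s] under p ~ id inverts [p]. Exactness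
    reduces the kernel to such classes, and it also reduces surjectivity to them, since [T]
    preserves the image in the base. *)
Lemma fiber_action_bijective (p : F -> F) (s : F)
    (T : {multiplicative homotopy_group R n.+1 (\val s) ->
                         homotopy_group R n.+1 (\val (p s))}) :
  continuous p -> homotopic R p id ->
  (forall c a b, represents c a -> represents (T c) b -> homo (f \o b) (f \o a)) ->
  (forall c y, based s y -> represents c (incl \o y) ->
    represents (T c) (incl \o (p \o y))) ->
  bijective T.
Proof.
move=> cp [M [cM M0 M1]] fT iT.
have ci : continuous incl := @continuous_sval _ _.
pose q u := M (s, u).
have cq : continuous q := path_family_cts cM.
have q0 : q zero = p s by exact: M0.
have q1 : q one = s by exact: M1.
have ciq : continuous (incl \o q) := continuous_scomp cq ci.
(* The homotopy [M] itself carries [p \o y] to [y], and the boundary, where [y] is [s], follows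
   [q]. *)
have pM (y : cube -> F) : based s y -> transports (q \o snd) (p \o y) y.
  move=> [cy ys]; exists (fun v => M (y v.1, v.2)); split.
  - apply: (continuous_scomp _ cM); apply: continuous_pair; last exact: continuous_snd.
    exact: continuous_scomp (@continuous_fst _ _) cy.
  - by move=> t; exact: M0.
  - by move=> t; exact: M1.
  - by move=> t u bt; rewrite /= ys.
apply: multiplicative_bijective => [c Tc1|d].
(* Injectivity: a class killed by [T] has null image in the base, so it is represented by some [y]
   in the fiber. Then [p \o y] is null in [S], and transport along [q] turns this into nullity of
   [y]. *)
- have [a ca] := represents_exists c; have [b Tcb] := represents_exists (T c).
  have fa : homo (f \o a) (fun=> r).
    apply: homotopic_rel_trans; first exact/homotopic_rel_sym/(fT _ _ _ ca Tcb).
    rewrite (_ : (fun=> r) = f \o (fun=> \val (p s))); last first.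
      by apply/funext => t /=; rewrite fiberE.
    apply: homotopic_rel_map; first exact: cts_fun.
    by apply: (represents_homotopic Tcb); rewrite Tc1; exact: represents_one.
  have [y ys ay] := deform_into_fiber (represents_based ca) fa.
  have iys : based (\val s) (incl \o y) by exact: based_map.
  have cy := homotopic_represents ca iys ay.
  have Tcy := iT _ _ ys cy.
  apply: (represents_inj _ (represents_one n)).
  apply: (homotopic_represents cy (cst_based n (\val s))).
  have q_cst := transports_path_cst n ciq.
  rewrite /= q0 q1 in q_cst.
  apply: (transports_unique (E := (incl \o q) \o snd) (x := \val s) _ _ _
      (transports_map ci (pM y ys)) q_cst).
  + exact: (continuous_scomp (@continuous_snd _ _) ciq).
  + by move=> t /=; rewrite q1.
  + by apply: (represents_homotopic Tcy); rewrite Tc1; exact: represents_one.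
(* Surjectivity: transport of [a] along [q] to the base point [s] gives a first candidate [e]. *)
- have [a da] := represents_exists d.
  have [] := @transports_path_exist R n S (incl \o q) a ciq.
    by rewrite /= q0; exact: represents_based da.
  rewrite /= q1 => b [bb ab]; have [e eb] := based_represents bb.
  have [b' Teb'] := represents_exists (T e).
  have [ba bb'] := (represents_based da, represents_based Teb').
  (* The path [q] lies in the fiber, so [f] turns the transport into a homotopy relative to the
     boundary; [T e] and [d] thus have the same image in the base. *)
  have fab : homo (f \o b') (f \o a).
    apply: homotopic_rel_trans; first exact: fT eb Teb'.
    apply/homotopic_rel_sym/(@transports_homotopic _ _ _ r).
    rewrite [X in transports X](_ : _ = f \o ((incl \o q) \o snd)).
      by apply: transports_map ab; exact: cts_fun.
    by apply/funext => t /=; rewrite fiberE.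
  have fbased x c : based (incl x) c -> based r (f \o c : cube -> O).
    move=> bc; have := based_map (@cts_fun _ _ f) bc.
    by rewrite /= fiberE.
  (* The error (T e)^-1 d has null image in the base, so it is represented by a map [z] into the
     fiber. *)
  pose w := concat (reverse b') a.
  have dw := represents_mul (represents_inv Teb') da.
  have fw : homo (f \o w) (fun=> r).
    rewrite (_ : f \o w = concat (reverse (f \o b')) (f \o a)); last first.
      by apply/funext => t; rewrite /w /concat /reverse /=; case: ifP.
    apply: homotopic_rel_trans (concatV_homotopic (fbased _ _ ba)).
    apply: (concat_homotopic (x := r)).
    + exact/reverse_based/fbased/bb'.
    + exact: fbased ba.
    + exact: reverse_homotopic.
    + by apply: homotopic_rel_refl; exact: (fbased _ _ ba).1.
  have [z zs wz] := deform_into_fiber (represents_based dw) fw.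
  (* The correction [e'] is the class of [z] carried along [q] to the base point [s]. *)
  have [] := @transports_path_exist R n F q z cq; first by rewrite q0.
  rewrite q1 => y [ys zy].
  have iys : based (\val s) (incl \o y) by exact: based_map.
  have [e' ey] := based_represents iys.
  exists (e * e')%g; rewrite gmulfM; apply: (canLR (mulVKg (T e))).
  have Tey := iT _ _ ys ey.
  apply: (represents_inj Tey).
  apply: (homotopic_represents dw (represents_based Tey)).
  apply: (homotopic_rel_trans wz); apply: homotopic_rel_map => //.
  (* Both [z] and [p \o y] arise from [y] by transport along the reversed path, so they are
     homotopic and [T e'] is the error term. *)
  apply: (transports_unique (E := fun v => q (flip v.2)) (x := p s) _ _ _
    (transports_rev zy) (transports_rev (pM y ys))).
  + apply: (continuous_scomp (f := fun v : cube * I => flip v.2) _ cq).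
    exact: continuous_scomp (@continuous_snd _ _) flip_continuous.
  + by move=> t /=; rewrite flip1.
  + by apply: homotopic_rel_refl; exact: ys.1.
Qed.

End fiber_action.

(** * The fiber map between the spaces of paths ending in the fibers *)

Section fiber_map.
Context {R : realType} {S1 S2 O : topologicalType}.
Context (f1 : continuousType S1 O) (f2 : continuousType S2 O).
Context (L1 : lifting_function R f1) (L2 : lifting_function R f2).
Context (rL1 : regular L1) (rL2 : regular L2) (r : O).
Local Notation I := (unit_interval R).
Local Notation F1 := (fiber f1 r).
Local Notation F2 := (fiber f2 r).
Context (g : F1 -> F2) (s : F1).
Local Notation G1 := (Gamma R F1 (\val s)).
Local Notation G2 := (Gamma R F2 (\val (g s))).

Lemma Gamma_zero (S : topologicalType) (F : set S) (x : S) (a : Gamma R F x) :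
  \val a zero = x.
Proof. by have [] := set_mem (valP a). Qed.

Lemma Gamma_eval_continuous (S : topologicalType) (F : set S) (x : S) :
  continuous (fun p : Gamma R F x * I => (\val p.1 : path_space R S) p.2).
Proof.
apply: eval_path_continuous; last exact: continuous_snd.
exact: continuous_scomp (@continuous_fst _ _) (@continuous_sval _ _).
Qed.

(** The affine map of the unit interval onto [u, 1], evaluated at [v]. *)
Let up (u v : I) : I := mix u v one.

(* For a path [a] in [S1], [track (a, u)] is the end point of the lift, from
   [a u], of the part of [f1 a] after time [u]. *)
Lemma fiber_track : exists (l : G1 -> loop_space R r) (track : G1 * I -> F1),
  [/\ continuous l /\ forall a v, (l a : I -> O) v = f1 (\val a v),
      continuous track, forall a, track (a, zero) = Lf_restriction L1 s (l a),
      forall a, track (a, one) = Gamma_end a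
    & forall (a : G1) (y : I -> F1), (forall v, \val a v = \val (y v)) ->
        forall u, track (a, u) = y u].
Proof.
have cev := @Gamma_eval_continuous S1 F1 (\val s).
have aone (a : G1) : f1 (\val a one) = r by exact: (fiberE (Gamma_end a)).
have [l [cl lE]] : exists l : G1 -> loop_space R r,
    continuous l /\ forall a v, (l a : I -> O) v = f1 (\val a v).
  have cf1 := continuous_scomp cev (@cts_fun _ _ f1).
  apply: (loop_family cf1) => a; last exact: aone.
  by rewrite /= Gamma_zero fiberE.
pose x (p : G1 * I) := \val p.1 p.2 : S1.
pose b (p : (G1 * I) * I) := f1 (\val p.1.1 (up p.1.2 p.2)).
have cup : continuous (fun p : (G1 * I) * I => (p.1.1, up p.1.2 p.2)).
  have c1 := @continuous_fst (G1 * I)%type I.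
  apply: continuous_pair; first exact: continuous_scomp c1 (@continuous_fst _ _).
  apply: mix_continuous; [|exact: continuous_snd|exact: continuous_cst].
  exact: continuous_scomp c1 (@continuous_snd _ _).
have cb : continuous b.
  exact: continuous_scomp (continuous_scomp cup cev) (@cts_fun _ _ f1).
have cx : continuous x by [].
have xb p : f1 (x p) = b (p, zero) by rewrite /b /up mix01.
have [P [cP P0 fP PL Pcst]] := lift_family_regular rL1 cx cb xb.
have PF p : F1 (P (p, one)) by rewrite /fiber/= fP /b/= /up mixx aone.
pose track p : F1 := SigSub (mem_set (PF p)).
have up1 v : up one v = one by exact: mix1.
exists l, track; split=> //.
- apply: continuous_sub; apply: (continuous_scomp _ cP).
  by apply: continuous_pair; [move=> ?|exact: continuous_cst].
- move=> a; apply: val_inj => /=; apply: PL; first by rewrite /x/= Gamma_zero.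
  by move=> v; rewrite [LHS]lE /b/= /up mix0.
- by move=> a; apply: val_inj; rewrite /= Pcst// => v; rewrite /b /x/= up1.
(* The projection of a path inside the fiber is constant, so by regularity every lift stays at its
   starting point. *)
- move=> a y ay u; apply: val_inj; rewrite /= Pcst ?/x ?ay// => v.
  by rewrite /b !ay !fiberE.
Qed.

(** The path [h a] consists of a lift of [f1 \o a] on the first quarter, the homotopy [K] on the
    second and the image of the track on the second half. The last two pieces lie in the fiber,
    whence [dbl (dbl v)]. If [a] lies in the fiber, the first half does not depend on [a]: it is the
    path [B]. *)
Lemma fiber_map_exists : continuous g ->
  homotopic R (Lf_restriction L2 (g s)) (g \o Lf_restriction L1 s) ->
  exists h : G1 -> G2, [/\ continuous h, Gamma_end \o h = g \o Gamma_end,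
    forall (a : G1) v, f2 (\val (h a) v) = f1 (\val a (dbl (dbl v)))
  & exists B : I -> F2, [/\ continuous B, B one = g s
    & forall (a : G1) (y : I -> F1), (forall v, \val a v = \val (y v)) ->
      forall v, \val (h a) v =
        \val (if uval v <= 2^-1 then B (dbl v) else g (y (dbl1 v)))]].
Proof.
move=> cg [K [cK K0 K1]].
have [l [track [[cl lE] ctr tr0 tr1 trF]]] := fiber_track.
have cev := @Gamma_eval_continuous S1 F1 (\val s).
have aone (a : G1) : f1 (\val a one) = r by exact: (fiberE (Gamma_end a)).
have cb : continuous (fun p : G1 * I => f1 (\val p.1 p.2)).
  exact: continuous_scomp cev (@cts_fun _ _ f1).
have cx : continuous (fun _ : G1 => \val (g s)) by exact: continuous_cst.
have [|P [cP P0 fP PL Pcst]] := lift_family_regular rL2 cx cb.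
  by move=> a /=; rewrite Gamma_zero !fiberE.
have P1 a : P (a, one) = \val (Lf_restriction L2 (g s) (l a)).
  by apply: PL => // v; rewrite [LHS]lE.
pose K' (p : G1 * I) := \val (K (l p.1, p.2)).
pose tr' (p : G1 * I) := \val (g (track p)).
have cK' : continuous K'.
  apply: (continuous_scomp _ (@continuous_sval _ _)).
  apply: (continuous_scomp _ cK); apply: continuous_pair; last exact: continuous_snd.
  exact: continuous_scomp (@continuous_fst _ _) cl.
have ctr' : continuous tr'.
  exact: continuous_scomp (continuous_scomp ctr cg) (@continuous_sval _ _).
pose H := chain (chain P K') tr'.
have cH : continuous H.
  apply: chain_continuous => //; first apply: chain_continuous => //.
    by move=> a; rewrite P1 /K' /= K0.
  by move=> a; rewrite chain1 /K' /= K1 /tr' tr0.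
have HG a : Gamma R F2 (\val (g s)) (path_family cH a).
  rewrite /Gamma /= !path_familyE /H !chain0 P0 chain1; split=> //.
  by rewrite /tr' /fiber/= fiberE.
exists (fun a => SigSub (mem_set (HG a))); split.
- by apply: continuous_sub; exact: path_family_continuous.
- by apply/funext => a; apply: val_inj; rewrite /= path_familyE /H chain1 /tr' tr1.
- move=> a v; rewrite /= path_familyE.
  have fK p : f2 (K' p) = r by exact: fiberE.
  rewrite /H chain_map chain_cst; last first.
    by move=> w; rewrite /= chain1 fK; exact: fiberE.
  rewrite /= chain_map chain_cst /= ?fP// => w.
  by rewrite [LHS]fK /= aone.
(* Every path in the fiber projects to the constant loop [c]. Regularity makes both restrictions at
   [c] return their base points, so [K] at [c] traces a loop at [g s]; [B] is this loop preceded by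
   a rest. *)
- pose c : loop_space R r := (cst r : {path I from r to r in O}).
  have Lc (S : topologicalType) (f : continuousType S O) (L : lifting_function R f)
      (z : fiber f r) : regular L -> Lf_restriction L z c = z.
    by move=> rL; apply: val_inj; apply: lift_const_path => // v; rewrite fiberE.
  pose Q (p : I * I) := K (c, p.2).
  have cQ : continuous Q.
    apply: (continuous_scomp _ cK); apply: continuous_pair; last exact: continuous_snd.
    exact: continuous_cst.
  have Q0 v : Q (v, zero) = g s by rewrite /Q K0 Lc.
  have Q1 v : Q (v, one) = g s by rewrite /Q K1 /= Lc.
  exists (fun u => chain (fun=> g s) Q (zero, u)); split.
  + apply: path_family_cts; apply: chain_continuous => //.
    exact: continuous_cst.
  + by rewrite chain1.
  + move=> a y ay v; rewrite /= path_familyE.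
    have lac : l a = c by apply/path_eqP => w; rewrite lE ay fiberE.
    have Pa w : P (a, w) = \val (g s).
      by apply: Pcst => u; rewrite /= ay !fiberE.
    rewrite /H /chain/= /tr' (trF _ _ ay) /K' lac; case: ifP => // _.
    by rewrite Pa; case: ifP.
Qed.

End fiber_map.

(** * The homomorphism of homotopy groups induced by the fiber map *)

Section homotopy_group_map.
Context {R : realType} (n : nat) {S1 S2 O : topologicalType}.
Context (f1 : continuousType S1 O) (f2 : continuousType S2 O) (r : O).
Local Notation I := (unit_interval R).
Local Notation F1 := (fiber f1 r).
Local Notation F2 := (fiber f2 r).
Context (g : F1 -> F2) (s : F1).
Local Notation G1 := (Gamma R F1 (\val s)).
Local Notation G2 := (Gamma R F2 (\val (g s))).
Local Notation cube := (cube R n.+2).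
Local Notation homo := (homotopic_rel R (@cube_boundary R n.+2)).
Local Notation at_max t v := (dfwith t ord_max v : cube).
Local Notation incl1 := (fun z : F1 => \val z).
Local Notation incl2 := (fun z : F2 => \val z).

(** In dimension n + 2 the last coordinate, along which paths are read, differs from the first,
    along which the group law concatenates. This is where the restriction to degrees above 1
    enters. *)
Lemma at_max_at0 (t : cube) u v : at_max (dfwith t ord0 u) v = dfwith (at_max t v) ord0 u.
Proof.
apply/functional_extensionality_dep => i.
have [<-|i0] := eqVneq ord0 i; first by rewrite dfwithout// !dfwithin.
have [<-|im] := eqVneq ord_max i; first by rewrite dfwithin dfwithout// dfwithin.
by rewrite !dfwithout.
Qed.

Lemma at_max_continuous (T : topologicalType) (q : T -> cube) (u : T -> I) :
  continuous q -> continuous u -> continuous (fun x => at_max (q x) (u x)).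
Proof. by move=> cq cu; exact: continuous_set_coord. Qed.

Context (h : G1 -> G2) (ch : continuous h).
Context (h_end : Gamma_end \o h = g \o Gamma_end).

(** Quantifying over every [c] with the values of the slice keeps the proof that slices belong to
    [Gamma] out of the definition. *)
Definition slicewise (a : cube -> S1) (A : cube -> S2) :=
  continuous A /\ forall (t : cube) (c : G1), (forall v, \val c v = a (at_max t v)) ->
    A t = \val (h c) (t ord_max).

Definition slice_in_Gamma (a : cube -> S1) :=
  forall t : cube, a (at_max t zero) = \val s /\ F1 (a (at_max t one)).

Lemma based_slice a : based (\val s) a -> slice_in_Gamma a.
Proof.
move=> [_ as_] t; rewrite !as_; first by split=> //; exact: fiberE.
- by exists ord_max; rewrite dfwithin; right.
- by exists ord_max; rewrite dfwithin; left.
Qed.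

(** The slices are curried into a continuous map to [Gamma], followed by [h] and by evaluation at
    the last coordinate. With the interval as [T] this handles homotopies. *)
Lemma slicewise_family (T : topologicalType) (a : cube * T -> S1) :
  continuous a -> (forall x, slice_in_Gamma (fun t => a (t, x))) ->
  exists A : cube * T -> S2, continuous A /\
    forall t x, exists2 c : G1, forall v, \val c v = a (at_max t v, x)
      & A (t, x) = \val (h c) (t ord_max).
Proof.
move=> ca aG.
pose b (p : (cube * T) * I) := a (at_max p.1.1 p.2, p.1.2).
have c1 := @continuous_fst (cube * T)%type I.
have cb : continuous b.
  apply: (continuous_scomp _ ca); apply: continuous_pair.
    apply: at_max_continuous; last exact: continuous_snd.
    exact: continuous_scomp c1 (@continuous_fst _ _).
  exact: continuous_scomp c1 (@continuous_snd _ _).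
have bG p : Gamma R F1 (\val s) (path_family cb p) by exact: (aG p.2 p.1).
pose c p : G1 := SigSub (mem_set (bG p)).
have cc : continuous c by apply: continuous_sub; exact: path_family_continuous.
exists (fun p => \val (h (c p)) (p.1 ord_max)); split.
  apply: (eval_path_continuous (a := fun p => \val (h (c p)))).
    exact: continuous_scomp (continuous_scomp cc ch) (@continuous_sval _ _).
  exact: continuous_scomp (@continuous_fst _ _) (@continuous_coord _ _ _).
by move=> t x; exists (c (t, x)).
Qed.

Lemma Gamma_ext (c c' : G1) : (forall v, \val c v = \val c' v) -> c = c'.
Proof. by move=> cc'; apply: val_inj; apply/continuousEP. Qed.

Lemma slicewise_exists a : based (\val s) a -> exists A, slicewise a A.
Proof.
move=> ba; have [A [cA AE]] := @slicewise_family I (a \o fst)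
  (continuous_scomp (@continuous_fst _ _) ba.1) (fun=> based_slice ba).
exists (fun t => A (t, zero)); split.
  apply: (continuous_scomp _ cA); apply: continuous_pair; last exact: continuous_cst.
  by move=> ?.
move=> t c ca; have [c' c'E ->] := AE t zero.
by rewrite (@Gamma_ext c c') // => v; rewrite ca c'E.
Qed.

Lemma const_Gamma : exists c : G1, forall v, \val c v = \val s.
Proof.
have cG : Gamma R F1 (\val s) (const_path R (\val s)).
  by split=> //; exact: fiberE.
by exists (SigSub (mem_set cG)).
Qed.

Lemma h_zero (c : G1) : \val (h c) zero = \val (g s).
Proof. exact: Gamma_zero. Qed.

Lemma h_one (c : G1) : \val c one = \val s -> \val (h c) one = \val (g s).
Proof.
move=> c1; have /(congr1 (fun k => k c)) /= hE := h_end.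
have -> : \val (h c) one = \val (Gamma_end (h c)) by [].
by rewrite hE; congr (\val (g _)); apply: val_inj.
Qed.

(** On the two faces of the last coordinate the value is an end point of [h c], hence [g s]; on the
    other faces the slice is constant. Since [h] may send the constant path to a nonconstant loop,
    the result need not be based, but its boundary values are the same for all [a]. *)
Lemma slice_boundary (a : cube -> S1) (c c0 : G1) t :
  (forall t, cube_boundary t -> a t = \val s) -> cube_boundary t ->
  (forall v, \val c v = a (at_max t v)) -> (forall v, \val c0 v = \val s) ->
  \val (h c) (t ord_max) = \val (h c0) (t ord_max).
Proof.
move=> as_ [i ti] ca c0s.
have [im|im] := eqVneq ord_max i.
  move: ti; rewrite -im => -[->|->]; first by rewrite !h_zero.
  by rewrite !h_one// ca as_//; exists ord_max; rewrite dfwithin; right.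
rewrite (@Gamma_ext c c0)// => v; rewrite ca c0s as_//.
by exists i; rewrite dfwithout.
Qed.

Lemma slice_exists (a : cube -> S1) : slice_in_Gamma a -> continuous a ->
  forall t, exists c : G1, forall v, \val c v = a (at_max t v).
Proof.
move=> aG ca t; have cat : continuous (fun v => a (at_max t v)).
  apply: (continuous_scomp _ ca); apply: at_max_continuous; first exact: continuous_cst.
  by move=> ?.
by exists (SigSub (mem_set (aG t : Gamma R F1 (\val s)
  (mkcts cat : continuousType _ _)))).
Qed.

Lemma slicewise_boundary a A (c0 : G1) (t : cube) : based (\val s) a ->
  slicewise a A -> cube_boundary t -> (forall v, \val c0 v = \val s) ->
  A t = \val (h c0) (t ord_max).
Proof.
move=> ba aA bt c0s; have [c ca] := slice_exists (based_slice ba) ba.1 t.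
by rewrite (aA.2 t c ca); exact: (slice_boundary ba.2 bt ca c0s).
Qed.

Lemma slicewise_concat a a' A A' : based (\val s) a -> based (\val s) a' ->
  slicewise a A -> slicewise a' A' -> slicewise (concat a a') (concat A A').
Proof.
move=> ba ba' aA aA'; split.
  have cv : continuous (fun t : cube => uval (t ord0)).
    exact: continuous_scomp (@continuous_coord _ _ _) continuous_val_unit.
  have cat0 (d : I -> I) : continuous d ->
      continuous (fun t : cube => dfwith t ord0 (d (t ord0)) : cube).
    move=> cd; apply: continuous_at0; first by move=> ?.
    exact: continuous_scomp (@continuous_coord _ _ _) cd.
  apply: paste_continuous => //.
  - exact: continuous_scomp (cat0 _ dbl_continuous) aA.1.
  - exact: continuous_scomp (cat0 _ dbl1_continuous) aA'.1.
  - move=> t ->; rewrite divff ?pnatr_eq0// addr0 subrr.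
    have [c0 c0s] := const_Gamma.
    rewrite (slicewise_boundary ba aA _ c0s); last by apply: boundary_at0_end; right.
    rewrite (slicewise_boundary ba' aA' _ c0s); last by apply: boundary_at0_end; left.
    by rewrite !dfwithout.
move=> t c cE.
have at_max0 v : at_max t v ord0 = t ord0 by rewrite dfwithout.
rewrite /concat; case: ifPn => t0.
  rewrite (aA.2 _ c); first by rewrite dfwithout.
  by move=> v; rewrite cE /concat at_max0 t0 at_max_at0.
rewrite (aA'.2 _ c); first by rewrite dfwithout.
by move=> v; rewrite cE /concat at_max0 (negbTE t0) at_max_at0.
Qed.

Lemma slicewise_homotopic a a' A A' : based (\val s) a -> based (\val s) a' ->
  slicewise a A -> slicewise a' A' -> homo a a' -> homo A A'.
Proof.
move=> ba ba' aA aA' [K [cK K0 K1 KA]].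
have bK u : based (\val s) (fun t => K (t, u)).
  split; last by move=> t bt; rewrite KA// ba.2.
  apply: (continuous_scomp _ cK); apply: continuous_pair; last exact: continuous_cst.
  by move=> ?.
have [H [cH HE]] := slicewise_family cK (fun u => based_slice (bK u)).
have Hu u : slicewise (fun t => K (t, u)) (fun t => H (t, u)).
  split.
    apply: (continuous_scomp _ cH); apply: continuous_pair; last exact: continuous_cst.
    by move=> ?.
  move=> t c cE; have [c' c'E ->] := HE t u.
  by rewrite (@Gamma_ext c c') // => v; rewrite cE c'E.
exists H; split=> //.
- move=> t; have [c cE ->] := HE t zero.
  by rewrite (aA.2 t c) // => v; rewrite cE K0.
- move=> t; have [c cE ->] := HE t one.
  by rewrite (aA'.2 t c) // => v; rewrite cE K1.
- move=> t u bt; have [c0 c0s] := const_Gamma.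
  by rewrite (slicewise_boundary (bK u) (Hu u) bt c0s) (slicewise_boundary ba aA bt c0s).
Qed.

Context (B : I -> F2) (cB : continuous B) (B1 : B one = g s).
Context (h_fiber : forall (c : G1) (y : I -> F1), (forall v, \val c v = \val (y v)) ->
  forall v, \val (h c) v =
    \val (if uval v <= 2^-1 then B (dbl v) else g (y (dbl1 v)))).
Context (f_h : forall (c : G1) v, f2 (\val (h c) v) = f1 (\val c (dbl (dbl v)))).
Context (cg : continuous g).

(* On the slices of a cube in the fiber, [h] is [B] followed by [g y]; the
   homotopy [forget_B y] retracts [B] to its end point. *)
Definition forget_B (y : cube -> F1) (p : cube * I) : F2 :=
  chain (fun q : (cube * I) * I => B (mix q.1.2 q.2 one))
        (fun q => g (y (at_max q.1.1 q.2))) (p, p.1 ord_max).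

(** The boundary motion that removes the loop left by [h]. The constant cube suffices because all
    [forget_B y] agree on the boundary; the [stretch] is the one produced by [transports_exist]. *)
Definition fiber_collar (p : cube * I) : S2 :=
  \val (forget_B (fun=> s) (stretch (uval p.2) p.1, p.2)).

Lemma forget_B_continuous y : based s y -> continuous (forget_B y).
Proof.
move=> [cy ys].
have c1 := @continuous_fst (cube * I)%type I.
have cW : continuous (chain (fun q : (cube * I) * I => B (mix q.1.2 q.2 one))
        (fun q => g (y (at_max q.1.1 q.2)))).
  apply: chain_continuous.
  - apply: (continuous_scomp _ cB); apply: mix_continuous.
    + exact: continuous_scomp c1 (@continuous_snd _ _).
    + exact: continuous_snd.
    + exact: continuous_cst.
  - apply: (continuous_scomp _ cg); apply: (continuous_scomp _ cy).
    apply: at_max_continuous; last exact: continuous_snd.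
    exact: continuous_scomp c1 (@continuous_fst _ _).
  - move=> p /=; rewrite mixx B1 ys//.
    by exists ord_max; rewrite dfwithin; left.
apply: (continuous_scomp _ cW); apply: continuous_pair; first by move=> ?.
exact: continuous_scomp (@continuous_fst _ _) (@continuous_coord _ _ _).
Qed.

Lemma forget_B_boundary y p : based s y -> cube_boundary p.1 ->
  forget_B y p = forget_B (fun=> s) p.
Proof.
move=> [_ ys] [i ti]; rewrite /forget_B /chain /=; case: ifPn => // p2.
rewrite ys//; have [im|im] := eqVneq ord_max i; last first.
  by exists i; rewrite dfwithout.
exists ord_max; rewrite dfwithin; right; move: ti p2; rewrite -im => -[->|->].
  by rewrite val_zero invr_ge0 ler0n.
by rewrite dbl1_one.
Qed.

Lemma forget_B_zero a A t y : a = incl1 \o y -> slicewise a A -> based s y ->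
  A t = \val (forget_B y (t, zero)).
Proof.
move=> -> aA ys; have iy : based (\val s) (incl1 \o y).
  exact: (based_map (@continuous_sval _ _) ys).
have [c cE] := slice_exists (based_slice iy) iy.1 t.
rewrite (aA.2 t c cE) (h_fiber cE) /forget_B /chain /=.
by rewrite mix0.
Qed.

Lemma slicewise_fiber_boundary a A t : based (\val s) a -> slicewise a A ->
  cube_boundary t -> A t = \val (forget_B (fun=> s) (t, zero)).
Proof.
move=> ba aA bt; have [c0 c0s] := const_Gamma.
rewrite (slicewise_boundary ba aA bt c0s) (h_fiber (y := fun=> s) c0s).
by rewrite /forget_B /chain /= mix0.
Qed.

Lemma forget_B_cst_one t : forget_B (fun=> s) (t, one) = g s.
Proof. by rewrite /forget_B /chain /= mix1 B1; case: ifP. Qed.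

Lemma fiber_collar_at0 (t : cube) v u :
  fiber_collar (dfwith t ord0 v : cube, u) = fiber_collar (t, u).
Proof.
rewrite /fiber_collar /forget_B /chain /=.
have -> : stretch (uval u) (dfwith t ord0 v) ord_max = stretch (uval u) t ord_max.
  by rewrite /stretch dfwithout.
by [].
Qed.

(** The slicewise image of a cube is made based by transport along [fiber_collar]. This boundary
    motion stays in the fiber and ignores the first coordinate, so the result respects projection to
    [O] and concatenation. *)
Lemma homotopy_group_map :
  exists phi : {multiplicative homotopy_group R n.+2 (\val s) ->
                               homotopy_group R n.+2 (\val (g s))},
    (forall c a b, represents c a -> represents (phi c) b ->
       homo (f2 \o b) (f1 \o a)) /\
    (forall c y, based s y -> represents c (incl1 \o y) ->
       represents (phi c) (incl2 \o (g \o y))).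
Proof.
have ci2 : continuous incl2 := @continuous_sval _ _.
have bs : based s (fun _ : cube => s) := cst_based n.+1 s.
have cE0 : continuous (incl2 \o forget_B (fun=> s)).
  exact: continuous_scomp (forget_B_continuous bs) ci2.
have cst_ : continuous (fun p : cube * I => (stretch (uval p.2) p.1, p.2)).
  apply: continuous_pair; last exact: continuous_snd.
  by apply: stretch_continuous; [exact: continuous_vsnd|exact: continuous_fst].
have cE : continuous fiber_collar := continuous_scomp cst_ cE0.
have E1 t : fiber_collar (t, one) = \val (g s).
  by rewrite /fiber_collar forget_B_cst_one.
pose rel a b := exists2 A, slicewise a A & transports fiber_collar A b.
have rel_ex a : based (\val s) a -> exists2 b, based (\val (g s)) b & rel a b.
  move=> ba; have [A aA] := slicewise_exists ba.
  have [|t|b [bb Ab]] := transports_exist (x := \val (g s)) cE0 aA.1.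
  - by move=> t bt; exact: slicewise_fiber_boundary ba aA bt.
  - by rewrite /= forget_B_cst_one.
  - by exists b => //; exists A.
have [||phi phiE] := @multiplicative_of_representatives R n.+1 S1 S2 _ _ rel rel_ex.
- move=> a a' b b' ba ba' [A aA Ab] [A' aA' Ab'] aa'.
  apply: (transports_unique cE E1 _ Ab Ab').
  exact: (slicewise_homotopic ba ba' aA aA' aa').
- move=> a a' b b' ba ba' [A aA Ab] [A' aA' Ab'].
  exists (concat A A'); first exact: slicewise_concat.
  by apply: transports_concat => // t v u; exact: fiber_collar_at0.
have cv (d : I -> I) : continuous d ->
    continuous (fun t : cube => at_max t (d (t ord_max))).
  move=> cd; apply: at_max_continuous; first by move=> ?.
  exact: continuous_scomp (@continuous_coord _ _ _) cd.
(* Reparametrizing the last coordinate with fixed end points does not change the class. *)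
have straight (X : topologicalType) (x : X) (a : cube -> X) (d : I -> I) :
    continuous d -> d zero = zero -> d one = one -> based x a ->
    homo (fun t => a (at_max t (d (t ord_max)))) a.
  move=> cd d0 d1 ba.
  apply: (straight_homotopic (q := id) ba (cv _ cd)) => [t|t [i ti]]; first by [].
  exists i; have [im|im] := eqVneq ord_max i; last by rewrite dfwithout.
  by rewrite -im dfwithin; move: ti; rewrite -im => -[] ->; rewrite ?d0 ?d1; split=> //;
    [left|right].
exists phi; split.
- move=> c a b ca phib.
  have ba := represents_based ca.
  have [b' bb' [A aA Ab']] := rel_ex a ba.
  have cf2 : continuous f2 := @cts_fun _ _ f2.
  apply: homotopic_rel_trans.
    apply: (homotopic_rel_map cf2); apply: (represents_homotopic phib).
    by apply: (phiE _ _ _ ca bb'); exists A.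
  (* Under [f2] the boundary motion becomes constant at [r], so the transport is a homotopy relative
     to the boundary. What remains is [f1 \o a] with its last coordinate reparametrized. *)
  apply: (homotopic_rel_trans (g := f2 \o A)).
    apply/homotopic_rel_sym/(@transports_homotopic _ _ _ r).
    rewrite [X in transports X](_ : _ = f2 \o fiber_collar); first exact: transports_map.
    by apply/funext => p /=; rewrite /fiber_collar fiberE.
  rewrite (_ : f2 \o A = fun t => (f1 \o a) (at_max t (dbl (dbl (t ord_max))))).
    apply: (straight _ r _ (dbl \o dbl)).
    + exact: continuous_scomp dbl_continuous dbl_continuous.
    + by rewrite /= !dbl0.
    + by rewrite /= !dbl_one.
    + by have := based_map (@cts_fun _ _ f1) ba; rewrite /= fiberE.
  apply/funext => t /=; have [d dE] := slice_exists (based_slice ba) ba.1 t.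
  by rewrite (aA.2 t d dE) f_h dE.
- move=> c y ys cy; have iy := represents_based cy.
  have [A aA] := slicewise_exists iy.
  have igy : based (\val (g s)) (incl2 \o (g \o y)).
    exact: (based_map ci2 (based_map cg ys)).
  pose z t : cube := at_max t (dbl1 (t ord_max)).
  have cW : continuous (incl2 \o forget_B y).
    exact: continuous_scomp (forget_B_continuous ys) ci2.
  (* For a cube in the fiber [forget_B y] itself is a transport. It ends with a rest at [g s]
     followed by [g \o y] at double speed, which is [g \o y] precomposed with [z]. *)
  have Ab : transports fiber_collar A (incl2 \o (g \o y) \o z \o stretch 1).
    exists (fun p => \val (forget_B y (stretch (uval p.2) p.1, p.2))); split.
    + exact: continuous_scomp cst_ cW.
    + by move=> t; rewrite val_zero stretch0 -(forget_B_zero _ (erefl _) aA ys).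
    + move=> t; rewrite val_one; set t' := stretch 1 t.
      rewrite /forget_B /chain /= mix1 B1 /z.
      case: ifPn => // t2; rewrite (_ : dbl1 _ = zero); last first.
        by rewrite /dbl1 clamp_le0//; lra.
      by rewrite ys.2//; exists ord_max; rewrite dfwithin; left.
    + move=> t u bt; rewrite /fiber_collar forget_B_boundary//.
      by apply: stretch_boundary => //; have /andP[] := unitP u.
  have bz : based (\val (g s)) (incl2 \o (g \o y) \o z).
    split; first exact: continuous_scomp (cv _ dbl1_continuous) igy.1.
    move=> t [i ti]; apply: igy.2; exists i; rewrite /z.
    have [im|im] := eqVneq ord_max i; last by rewrite dfwithout.
    by rewrite -im dfwithin; move: ti; rewrite -im => -[] ->;
      [left; exact: dbl1_zero|right; exact: dbl1_one].
  have bzs : based (\val (g s)) (incl2 \o (g \o y) \o z \o stretch 1).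
    split; last by move=> t bt; apply: bz.2; exact: stretch_boundary.
    apply: continuous_scomp bz.1; apply: stretch_continuous.
      exact: continuous_cst.
    by move=> ?.
  have phic : represents (phi c) (incl2 \o (g \o y) \o z \o stretch 1).
    by apply: (phiE _ _ _ cy bzs); exists A.
  apply: (homotopic_represents phic igy).
  apply: (homotopic_rel_trans (stretch_homotopic ler01 bz)).
  apply: straight igy.
  + exact: dbl1_continuous.
  + exact: dbl1_zero.
  + exact: dbl1_one.
Qed.

End homotopy_group_map.

Lemma fiber_map_homotopy_group (R : realType) (n : nat)
    (S1 S2 O : topologicalType) (f1 : continuousType S1 O)
    (f2 : continuousType S2 O) (L1 : lifting_function R f1)
    (L2 : lifting_function R f2) (r : O) (g : fiber f1 r -> fiber f2 r)
    (s : fiber f1 r) :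
  regular L1 -> regular L2 -> continuous g ->
  homotopic R (Lf_restriction L2 (g s)) (g \o Lf_restriction L1 s) ->
  exists phi : {multiplicative homotopy_group R n.+2 (\val s) ->
                               homotopy_group R n.+2 (\val (g s))},
    (forall c a b, represents c a -> represents (phi c) b ->
       homotopic_rel R (@cube_boundary R n.+2) (f2 \o b) (f1 \o a)) /\
    (forall c y, based s y -> represents c ((fun z => \val z) \o y) ->
       represents (phi c) ((fun z => \val z) \o (g \o y))).
Proof.
move=> rL1 rL2 cg conj_g.
have [h [ch h_end f_h [B [cB B1 h_fiber]]]] := fiber_map_exists rL1 rL2 cg conj_g.
exact (homotopy_group_map n ch h_end cB B1 h_fiber f_h cg).
Qed.

(** * Free homotopies and the dependence of restrictions on the base point *)

Section free_homotopies.
Context {R : realType}.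

Lemma homotopicE (X Y : topologicalType) (f g : X -> Y) :
  homotopic R f g <-> homotopic_rel R set0 f g.
Proof.
by split=> [[H [cH H0 H1]]|[H [cH H0 H1 _]]]; exists H.
Qed.

Lemma homotopic_sym (X Y : topologicalType) (f g : X -> Y) :
  homotopic R f g -> homotopic R g f.
Proof. by move=> /homotopicE fg; apply/homotopicE; exact: homotopic_rel_sym. Qed.

Lemma homotopic_trans (X Y : topologicalType) (f g h : X -> Y) :
  homotopic R f g -> homotopic R g h -> homotopic R f h.
Proof.
move=> /homotopicE fg /homotopicE gh; apply/homotopicE.
exact: homotopic_rel_trans fg gh.
Qed.

Lemma homotopic_compl (X Y Z : topologicalType) (f g : X -> Y) (k : Y -> Z) :
  continuous k -> homotopic R f g -> homotopic R (k \o f) (k \o g).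
Proof.
move=> ck /homotopicE fg; apply/homotopicE; exact: homotopic_rel_map.
Qed.

Lemma homotopic_compr (X Y Z : topologicalType) (f g : Y -> Z) (k : X -> Y) :
  continuous k -> homotopic R f g -> homotopic R (f \o k) (g \o k).
Proof.
move=> ck [H [cH H0 H1]]; exists (fun p => H (k p.1, p.2)); split.
- apply: (continuous_scomp _ cH); apply: continuous_pair; last exact: continuous_snd.
  exact: continuous_scomp (@continuous_fst _ _) ck.
- by move=> x /=; rewrite H0.
- by move=> x /=; rewrite H1.
Qed.

Context {S O : topologicalType} (f : continuousType S O).
Context (L : lifting_function R f) (r : O).

Lemma Lf_function_continuous : continuous (@Lf_function _ _ _ f L r).
Proof.
apply: continuous_sub => /=.
pose q (p : loop_space R r * fiber f r) := lifting_pair (lift_fiber_subproof p.1 p.2).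
have cq : continuous q.
  apply: continuous_sub; apply: continuous_pair.
    exact: continuous_scomp (@continuous_snd _ _) (@continuous_sval _ _).
  apply: (continuous_scomp (@continuous_fst _ _)).
  apply: (@continuous_comp_initial _ _ _
    (id : path_space R O -> {compact-open, unit_interval R -> O})).
  exact: (@initial_continuous _ _
    (id : {path (unit_interval R) from r to r in O} ->
          {compact-open, unit_interval R -> O})).
apply: (eval_path_continuous (a := fun p => L (q p)) (u := fun=> one)).
  exact: continuous_scomp cq (@lift_path_continuous _ _ _ _ L).
exact: continuous_cst.
Qed.

Lemma Lf_restriction_continuous (s : fiber f r) : continuous (Lf_restriction L s).
Proof.
apply: (continuous_scomp _ Lf_function_continuous).
by apply: continuous_pair; [move=> ?|exact: continuous_cst].
Qed.

(** The homotopy from [p] to the identity moves the starting point of the lifts from [p s] to [s]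
    inside the fiber. *)
Lemma Lf_restriction_homotopic (p : fiber f r -> fiber f r) (s : fiber f r) :
  homotopic R p id -> homotopic R (Lf_restriction L (p s)) (Lf_restriction L s).
Proof.
move=> [M [cM M0 M1]]; exists (fun a => Lf_function L (a.1, M (s, a.2))); split.
- apply: (continuous_scomp _ Lf_function_continuous); apply: continuous_pair.
    exact: continuous_fst.
  apply: (continuous_scomp _ cM); apply: continuous_pair; last exact: continuous_snd.
  exact: continuous_cst.
- by move=> a; rewrite M0.
- by move=> a; rewrite M1.
Qed.

End free_homotopies.

Theorem theorem4p1 (R : realType) (S1 S2 O : topologicalType)
    (hS1 : hausdorff_space S1) (hS2 : hausdorff_space S2)
    (hO : hausdorff_space O)
    (f1 : continuousType S1 O) (f2 : continuousType S2 O)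
    (fib1 : regular_fibration R f1) (fib2 : regular_fibration R f2)
    (L1 : lifting_function R f1) (L2 : lifting_function R f2)
    (regL1 : regular L1) (regL2 : regular L2)
    (r : O) (s : fiber f1 r)
    (g : fiber f1 r -> fiber f2 r) (g' : fiber f2 r -> fiber f1 r)
    (equiv_g : homotopy_equivalence R g g')
    (conj_g : homotopic R (Lf_restriction L1 s)
                          (g' \o Lf_restriction L2 (g s))) :
  [/\ exists h : Gamma R (fiber f1 r) (\val s) ->
                 Gamma R (fiber f2 r) (\val (g s)),
        continuous h /\ Gamma_end \o h = g \o Gamma_end,
      exists k : Gamma R (fiber f2 r) (\val (g s)) ->
                 Gamma R (fiber f1 r) (\val ((g' \o g) s)),
        continuous k /\ Gamma_end \o k = g' \o Gamma_end
    & forall n : nat,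
        isomorphic_groups (homotopy_group R n.+2 (\val s))
                          (homotopy_group R n.+2 (\val (g s)))].
Proof.
have [cg cg' g'g gg'] := equiv_g.
(* Composing the given conjugacy with [g] and contracting [g \o g'] yields the form that
   [fiber_map_exists] asks for. *)
have conj1 : homotopic R (Lf_restriction L2 (g s)) (g \o Lf_restriction L1 s).
  apply/homotopic_sym/(homotopic_trans (homotopic_compl cg conj_g)).
  exact: (homotopic_compr (@Lf_restriction_continuous _ _ _ _ L2 r (g s)) gg').
have conj2 : homotopic R (Lf_restriction L1 (g' (g s)))
    (g' \o Lf_restriction L2 (g s)).
  exact: homotopic_trans (Lf_restriction_homotopic L1 s g'g) conj_g.
(* The same conjugacy for [g] at the base point [g' (g s)], needed for a third homomorphism that
   follows the one induced by [g']. *)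
have conj3 : homotopic R (Lf_restriction L2 (g (g' (g s))))
    (g \o Lf_restriction L1 (g' (g s))).
  apply: homotopic_trans (Lf_restriction_homotopic L2 (g s) gg') _.
  apply: (homotopic_trans conj1); apply: (homotopic_compl cg).
  exact/homotopic_sym/(Lf_restriction_homotopic L1 s g'g).
split=> [||n].
- by have [h [ch h_end _ _]] := fiber_map_exists regL1 regL2 cg conj1; exists h.
- by have [k [ck k_end _ _]] := fiber_map_exists regL2 regL1 cg' conj2; exists k.
have [phi1 [f_phi1 i_phi1]] := fiber_map_homotopy_group n regL1 regL2 cg conj1.
have [phi2 [f_phi2 i_phi2]] := fiber_map_homotopy_group n regL2 regL1 cg' conj2.
have [phi3 [f_phi3 i_phi3]] := fiber_map_homotopy_group n regL1 regL2 cg conj3.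
(* Two consecutive homomorphisms compose to one over [O] that is induced by [g' \o g] on the fiber,
   a map homotopic to the identity. *)
have bij21 : bijective (phi2 \o phi1).
  apply: (@fiber_action_bijective _ n.+1 _ _ f1 L1 regL1 r (g' \o g) s).
  - exact: continuous_scomp cg cg'.
  - exact: g'g.
  - move=> c a b ca cb; have [d dc] := represents_exists (phi1 c).
    exact: homotopic_rel_trans (f_phi2 _ _ _ dc cb) (f_phi1 _ _ _ ca dc).
  - move=> c y ys cy; apply: (i_phi2 _ (g \o y)); first exact: based_map.
    exact: i_phi1.
have bij32 : bijective (phi3 \o phi2).
  apply: (@fiber_action_bijective _ n.+1 _ _ f2 L2 regL2 r (g \o g') (g s)).
  - exact: continuous_scomp cg' cg.
  - exact: gg'.
  - move=> c a b ca cb; have [d dc] := represents_exists (phi2 c).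
    exact: homotopic_rel_trans (f_phi3 _ _ _ dc cb) (f_phi2 _ _ _ ca dc).
  - move=> c y ys cy; apply: (i_phi3 _ (g' \o y)); first exact: based_map.
    exact: i_phi2.
(* Bijectivity of [phi3 \o phi2] gives injectivity of [phi2]; an inverse [k] of [phi2 \o phi1] then
   makes [k \o phi2] a two-sided inverse of [phi1]. *)
have inj2 : injective phi2 by move=> x y xy; apply: (bij_inj bij32); rewrite /= xy.
exists phi1; have [k k1 k2] := bij21.
exists (k \o phi2) => x; first exact: k1.
by apply: inj2; exact: k2.
Qed.
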